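(* Every connected solvable affine algebraic group over $k$ is equivariantly flattenable.
   Context: $k$ is an algebraically closed field of characteristic zero; varieties and algebraic groups are over $k$, the topology is the Zariski topology, and actions of algebraic groups on varieties are algebraic (morphic) left actions. A variety $X$ endowed with an action of an algebraic group $G$ is called equivariantly flattenable if there are an action of $G$ on some affine space $\mathbf A^n$ and a $G$-equivariant open embedding $X\hookrightarrow \mathbf A^n$. An algebraic group $G$ is called equivariantly flattenable if $G$, as a variety endowed with the $G$-action by left multiplication, is equivariantly flattenable. *)

(* Defs.v *)
From HB Require Import structures.
From mathcomp Require Import all_boot all_order all_algebra.
From mathcomp Require Import mpoly.

Set Implicit Arguments.
Unset Strict Implicit.
Unset Printing Implicit Defensive.

Import GRing.Theory.
Local Open Scope ring_scope.

(* The affine space A^n is 'rV[k]_n; the value of p : {mpoly k[n]} at the point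
   v is p.@[v 0], where v 0 : 'I_n -> k lists the coordinates of v. *)

Definition zariski_closed (k : fieldType) (n : nat) (Z : 'rV[k]_n -> Prop) :=
  exists S : {mpoly k[n]} -> Prop,
    forall v, Z v <-> (forall p, S p -> p.@[v 0] = 0).

Definition zariski_open (k : fieldType) (n : nat) (U : 'rV[k]_n -> Prop) :=
  zariski_closed (fun v => ~ U v).

(* A structure of affine variety on the set X, given by a bijection onto a
   closed subset of an affine space. Varieties may be reducible. *)
Record affine_variety (k : fieldType) (X : Type) := AffineVariety {
  av_dim : nat;
  av_coord : X -> 'rV[k]_av_dim;
  av_coord_inj : injective av_coord;
  av_coord_closed : zariski_closed (fun v => exists x, v = av_coord x)
}.

Definition affine_space_variety (k : fieldType) (n : nat) :
  affine_variety k 'rV[k]_n.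
Proof.
exists n id; first by [].
by exists (fun=> False) => v; split=> [_ p []|_]; exists v.
Defined.

Definition prod_variety (k : fieldType) (X Y : Type)
  (V : affine_variety k X) (W : affine_variety k Y) :
  affine_variety k (X * Y).
Proof.
exists (av_dim V + av_dim W)%N
  (fun z => row_mx (av_coord V z.1) (av_coord W z.2)).
- move=> [x y] [x' y'] /eq_row_mx [/= ex ey].
  by rewrite (av_coord_inj ex) (av_coord_inj ey).
- case: (av_coord_closed V) => SV SVP; case: (av_coord_closed W) => SW SWP.
  pose L := [tuple 'X_(lshift (av_dim W) i) : {mpoly k[_]} | i < av_dim V].
  pose R := [tuple 'X_(rshift (av_dim V) i) : {mpoly k[_]} | i < av_dim W].
  exists (fun p => (exists2 q, SV q & p = comp_mpoly L q) \/
                   (exists2 q, SW q & p = comp_mpoly R q)) => v.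
  have eL q : (comp_mpoly L q).@[v 0] = q.@[lsubmx v 0].
    by rewrite comp_mpoly_meval; apply: meval_eq => i;
       rewrite tnth_mktuple mevalXU mxE.
  have eR q : (comp_mpoly R q).@[v 0] = q.@[rsubmx v 0].
    by rewrite comp_mpoly_meval; apply: meval_eq => i;
       rewrite tnth_mktuple mevalXU mxE.
  split.
  + move=> [[x y] ev] p [] [q Sq ->].
    * rewrite eL ev row_mxKl; have [+ _] := SVP (av_coord V x).
      by apply=> //; exists x.
    * rewrite eR ev row_mxKr; have [+ _] := SWP (av_coord W y).
      by apply=> //; exists y.
  + move=> Sv.
    have [|x ex] := (SVP (lsubmx v)).2.
      by move=> p Sp; rewrite -eL; apply: Sv; left; exists p.
    have [|y ey] := (SWP (rsubmx v)).2.
      by move=> p Sp; rewrite -eR; apply: Sv; right; exists p.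
    by exists (x, y); rewrite /= -ex -ey hsubmxK.
Defined.

(* A morphism of affine varieties is the restriction of a polynomial map. *)
Definition is_morphism (k : fieldType) (X Y : Type)
    (V : affine_variety k X) (W : affine_variety k Y) (f : X -> Y) :=
  exists F : 'I_(av_dim W) -> {mpoly k[av_dim V]},
    forall x j, av_coord W (f x) 0 j = (F j).@[av_coord V x 0].

Definition closed_in (k : fieldType) (X : Type)
    (V : affine_variety k X) (A : X -> Prop) :=
  exists Z : 'rV[k]_(av_dim V) -> Prop,
    zariski_closed Z /\ forall x, A x <-> Z (av_coord V x).

Definition is_connected (k : fieldType) (X : Type) (V : affine_variety k X) :=
  (exists x : X, True) /\
  forall A B : X -> Prop,
    closed_in V A -> closed_in V B ->
    (forall x, A x \/ B x) -> (forall x, ~ (A x /\ B x)) ->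
    (forall x, ~ A x) \/ (forall x, ~ B x).

(* f is regular on the subset U of A^n: locally a quotient of polynomials. *)
Definition regular_on (k : fieldType) (n : nat)
    (U : 'rV[k]_n -> Prop) (f : 'rV[k]_n -> k) :=
  forall v, U v ->
    exists N : 'rV[k]_n -> Prop, [/\ zariski_open N, N v &
      exists p q : {mpoly k[n]}, forall w, U w -> N w ->
        q.@[w 0] != 0 /\ f w = p.@[w 0] / q.@[w 0]].

(* f is a morphism, its image is open, and the inverse bijection from the image
   to X, read in the coordinates of X (this is psi), is regular on the image.
   The injectivity of f follows from the equation on psi. *)
Definition open_embedding (k : fieldType) (X : Type) (V : affine_variety k X)
    (n : nat) (f : X -> 'rV[k]_n) :=
  let image := fun v => exists x, v = f x in
  [/\ is_morphism V (affine_space_variety k n) f,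
      zariski_open image &
      exists psi : 'rV[k]_n -> 'rV[k]_(av_dim V),
        (forall x, psi (f x) = av_coord V x) /\
        (forall i, regular_on image (fun v => psi v 0 i))].

Record affine_algebraic_group (k : fieldType) := AffineAlgebraicGroup {
  aag_group :> groupType;
  aag_variety : affine_variety k aag_group;
  aag_mul_morphism :
    is_morphism (prod_variety aag_variety aag_variety) aag_variety
      (fun z => (z.1 * z.2)%g);
  aag_inv_morphism : is_morphism aag_variety aag_variety (fun x => (x^-1)%g)
}.

Record algebraic_action (k : fieldType) (G : affine_algebraic_group k)
    (X : Type) (V : affine_variety k X) := AlgebraicAction {
  act_fun :> G -> X -> X;
  act_one : forall x, act_fun 1%g x = x;
  act_mul : forall g h x, act_fun (g * h)%g x = act_fun g (act_fun h x);
  act_morphism :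
    is_morphism (prod_variety (aag_variety G) V) V (fun z => act_fun z.1 z.2)
}.

Definition left_multiplication (k : fieldType) (G : affine_algebraic_group k) :
    algebraic_action G (aag_variety G) :=
  @AlgebraicAction k G G (aag_variety G) (fun g x => (g * x)%g)
    (@mul1g G) (fun g h x => esym (mulgA g h x)) (aag_mul_morphism G).

(* Stated for affine X, the case of a group acting on itself. *)
Definition equivariantly_flattenable (k : fieldType)
    (G : affine_algebraic_group k) (X : Type) (V : affine_variety k X)
    (a : algebraic_action G V) :=
  exists (n : nat) (b : algebraic_action G (affine_space_variety k n))
         (f : X -> 'rV[k]_n),
    open_embedding V f /\ forall g x, f (a g x) = b g (f x).

Definition equivariantly_flattenable_group (k : fieldType)
    (G : affine_algebraic_group k) :=
  equivariantly_flattenable (left_multiplication G).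

Inductive derived_subgroup (G : groupType) (H : G -> Prop) : G -> Prop :=
| derived_comm x y : H x -> H y -> derived_subgroup H (commg x y)
| derived_one : derived_subgroup H 1%g
| derived_mul x y : derived_subgroup H x -> derived_subgroup H y ->
    derived_subgroup H (x * y)%g
| derived_inv x : derived_subgroup H x -> derived_subgroup H (x^-1)%g.

(* The library's [solvable] is for finite groups only. *)
Definition solvable_group (G : groupType) :=
  exists n : nat,
    forall x, iter n (@derived_subgroup G) (fun=> True) x -> x = 1%g.

(* Main.v *)
(* Left multiplication is made algebraic on an affine space by finding
   u_1, ..., u_n in k[G], algebraically independent, such that k[u] is stable
   under left translations and k[G] = k[u][1/w] for a character w in k[u]: then
   u embeds G onto {w <> 0}, and the action extends to A^n because identities
   between polynomials in u can be checked on G.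
   By Lie-Kolchin, k[G] is generated by v_1, ..., v_m spanning a triangular
   module for left translations.  Its diagonal characters a_j generate a group
   that is torsion-free by connectedness; a basis of it is the first part of u,
   and w is the product of this basis.  Then v_j / a_j is changed by translations
   only by elements of the algebra B = k[u][1/w] obtained so far.  In
   characteristic zero it either lies in B or is transcendental over B: B has no
   nontrivial stable ideals, so an algebraic relation of minimal degree can be
   taken monic, and its second coefficient gives a translation-invariant element,
   that is, a constant.  In the second case w^N (v_j / a_j), with N large, is
   adjoined to u. *)

Require Import Defs.
From mathcomp Require Import all_boot all_order all_algebra.
From mathcomp Require Import mpoly.
From Stdlib Require Import Classical FunctionalExtensionality.

Set Implicit Arguments.
Unset Strict Implicit.
Unset Printing Implicit Defensive.

Import GRing.Theory.
Local Open Scope ring_scope.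

(** * Least and greatest elements of sets of natural numbers *)

Lemma ex_minnat (P : nat -> Prop) :
  (exists n, P n) -> exists n, P n /\ forall m, (m < n)%N -> ~ P m.
Proof.
case=> n; elim/ltn_ind: n => n IH Pn.
have [[m [ltmn Pm]]|noP] := classic (exists m, (m < n)%N /\ P m).
  exact: IH ltmn Pm.
by exists n; split=> // m ltmn Pm; apply: noP; exists m.
Qed.

Lemma ex_maxnat (P : nat -> Prop) b :
  (exists n, P n) -> (forall n, P n -> (n <= b)%N) ->
  exists n, P n /\ forall m, P m -> (m <= n)%N.
Proof.
move=> [n Pn] leb; have [|m [[c Pc ec] minm]] :=
  @ex_minnat (fun m => exists2 c, P c & m = (b - c)%N).
  by exists (b - n)%N, n.
exists c; split=> // d Pd; rewrite leqNgt; apply/negP => ltcd.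
apply: (minm (b - d)%N); last by exists d.
by rewrite ec ltn_sub2l // (leq_trans ltcd) ?leb.
Qed.

(** * Polynomial functions *)

Section Polyfun.

Variable k : fieldType.

(** The algebra k[c] generated by the components of an arbitrary map [c]. As [T] is any type, the
    same notion covers k[G], k[u], functions on G x G and functions on a subset of affine space. *)
Definition polyfun (T : Type) (n : nat) (c : T -> 'rV[k]_n) (f : T -> k) :=
  exists p : {mpoly k[n]}, forall x, f x = p.@[c x 0].

Variables (T : Type) (n : nat) (c : T -> 'rV[k]_n).
Implicit Types f g : T -> k.

Lemma polyfun_ext f g : f =1 g -> polyfun c f -> polyfun c g.
Proof. by move=> eq_fg [p fE]; exists p => x; rewrite -eq_fg. Qed.

Lemma polyfun_cst a : polyfun c (fun=> a).
Proof. by exists a%:MP => x; rewrite mevalC. Qed.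

Lemma polyfun_coord i : polyfun c (fun x => c x 0 i).
Proof. by exists 'X_i => x; rewrite mevalXU. Qed.

Lemma polyfunD f g :
  polyfun c f -> polyfun c g -> polyfun c (fun x => f x + g x).
Proof. by move=> [p fE] [q gE]; exists (p + q) => x; rewrite mevalD fE gE. Qed.

Lemma polyfunM f g :
  polyfun c f -> polyfun c g -> polyfun c (fun x => f x * g x).
Proof. by move=> [p fE] [q gE]; exists (p * q) => x; rewrite mevalM fE gE. Qed.

Lemma polyfunX f m : polyfun c f -> polyfun c (fun x => f x ^+ m).
Proof. by move=> [p fE]; exists (p ^+ m) => x; rewrite rmorphXn /= fE. Qed.

Lemma polyfun_sum (I : Type) (r : seq I) (P : pred I) (F : I -> T -> k) :
  (forall i, P i -> polyfun c (F i)) ->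
  polyfun c (fun x => \sum_(i <- r | P i) F i x).
Proof.
move=> cF; elim: r => [|i r IH].
  by apply: polyfun_ext (polyfun_cst 0) => x; rewrite big_nil.
have [Pi|nPi] := boolP (P i).
  by apply: polyfun_ext (polyfunD (cF i Pi) IH) => x; rewrite big_cons Pi.
by apply: polyfun_ext IH => x; rewrite big_cons (negPf nPi).
Qed.

Lemma polyfun_prod (I : Type) (r : seq I) (P : pred I) (F : I -> T -> k) :
  (forall i, P i -> polyfun c (F i)) ->
  polyfun c (fun x => \prod_(i <- r | P i) F i x).
Proof.
move=> cF; elim: r => [|i r IH].
  by apply: polyfun_ext (polyfun_cst 1) => x; rewrite big_nil.
have [Pi|nPi] := boolP (P i).
  by apply: polyfun_ext (polyfunM (cF i Pi) IH) => x; rewrite big_cons Pi.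
by apply: polyfun_ext IH => x; rewrite big_cons (negPf nPi).
Qed.

Lemma polyfun_comp S (h : S -> T) f :
  polyfun c f -> polyfun (fun y => c (h y)) (fun y => f (h y)).
Proof. by move=> [p fE]; exists p => y; rewrite fE. Qed.

Lemma polyfun_trans m (d : T -> 'rV[k]_m) f :
  (forall i, polyfun d (fun x => c x 0 i)) -> polyfun c f -> polyfun d f.
Proof.
move=> /fin_all_exists[q qE] [p fE]; exists (p \mPo [tuple q i | i < n]) => x.
by rewrite comp_mpoly_meval fE; apply: meval_eq => i; rewrite tnth_mktuple qE.
Qed.

End Polyfun.

Lemma polyfun_row_mx (k : fieldType) (T : Type) n m l (c : T -> 'rV[k]_n)
    (d : T -> 'rV[k]_m) (e : T -> 'rV[k]_l) :
  (forall i, polyfun e (fun x => c x 0 i)) ->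
  (forall i, polyfun e (fun x => d x 0 i)) ->
  forall i, polyfun e (fun x => row_mx (c x) (d x) 0 i).
Proof.
move=> ce de i; case: (split_ordP i) => j ->.
  by apply: polyfun_ext (ce j) => x; rewrite row_mxEl.
by apply: polyfun_ext (de j) => x; rewrite row_mxEr.
Qed.

Lemma polyfun_fst (k : fieldType) (T S : Type) n m (c : T -> 'rV[k]_n)
    (d : S -> 'rV[k]_m) (f : T -> k) :
  polyfun c f -> polyfun (fun z => row_mx (c z.1) (d z.2)) (fun z => f z.1).
Proof.
pose R (z : T * S) := row_mx (c z.1) (d z.2).
move=> fP; apply: polyfun_trans (polyfun_comp fst fP) => i.
by apply: polyfun_ext (polyfun_coord R (lshift m i)) => z; rewrite row_mxEl.
Qed.

Lemma polyfun_snd (k : fieldType) (T S : Type) n m (c : T -> 'rV[k]_n)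
    (d : S -> 'rV[k]_m) (f : S -> k) :
  polyfun d f -> polyfun (fun z => row_mx (c z.1) (d z.2)) (fun z => f z.2).
Proof.
pose R (z : T * S) := row_mx (c z.1) (d z.2).
move=> fP; apply: polyfun_trans (polyfun_comp snd fP) => i.
by apply: polyfun_ext (polyfun_coord R (rshift n i)) => z; rewrite row_mxEr.
Qed.

(** Each monomial of [p] splits into its part in the first variables and its part in the last ones,
    so there is one summand per monomial. *)
Lemma polyfun_separated (k : fieldType) (T S : Type) n m (c : T -> 'rV[k]_n)
    (d : S -> 'rV[k]_m) (F : T * S -> k) :
  polyfun (fun z => row_mx (c z.1) (d z.2)) F ->
  exists (t : nat) (a : 'I_t -> T -> k) (b : 'I_t -> S -> k),
    [/\ forall j, polyfun c (a j), forall j, polyfun d (b j) &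
        forall x y, F (x, y) = \sum_j a j x * b j y].
Proof.
move=> [p FE]; exists (size (msupp p)).
pose e (j : 'I_(size (msupp p))) := tnth (in_tuple (msupp p)) j.
exists (fun j x => p@_(e j) * \prod_i c x 0 i ^+ e j (lshift m i)).
exists (fun j y => \prod_i d y 0 i ^+ e j (rshift n i)); split=> [j|j|x y].
- apply: polyfunM; first exact: polyfun_cst.
  by apply: polyfun_prod => i _; apply/polyfunX/polyfun_coord.
- by apply: polyfun_prod => i _; apply/polyfunX/polyfun_coord.
rewrite FE mevalE big_tnth; apply: eq_bigr => j _.
rewrite big_split_ord /= -mulrA; congr (_ * (_ * _)).
  by apply: eq_bigr => i _; rewrite row_mxEl.
by apply: eq_bigr => i _; rewrite row_mxEr.
Qed.

(** * Fractions whose denominators are powers of one function *)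

Section Localization.

Variables (k : fieldType) (T : Type) (n : nat) (u : T -> 'rV[k]_n) (w : T -> k).

(* The algebra k[u][1/w], for w in k[u] without zeros. *)
Definition localization (f : T -> k) :=
  exists N, polyfun u (fun x => w x ^+ N * f x).

Hypothesis wP : polyfun u w.

Lemma localization_le f N : polyfun u (fun x => w x ^+ N * f x) ->
  forall M, (N <= M)%N -> polyfun u (fun x => w x ^+ M * f x).
Proof.
move=> fP M le; apply: polyfun_ext (polyfunM (polyfunX (M - N) wP) fP) => x.
by rewrite mulrA -exprD subnK.
Qed.

Lemma localization_polyfun f : polyfun u f -> localization f.
Proof. by move=> fP; exists 0%N; apply: polyfun_ext fP => x; rewrite mul1r. Qed.

Lemma localizationD b c : localization b -> localization c ->
  localization (fun x => b x + c x).
Proof.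
move=> [N bP] [M cP]; exists (maxn N M).
apply: polyfun_ext (polyfunD (localization_le bP (leq_maxl N M))
                             (localization_le cP (leq_maxr N M))) => x.
by rewrite mulrDr.
Qed.

Lemma localization_ext b c :
  b =1 c -> localization b -> localization c.
Proof.
by move=> bc [N bP]; exists N; apply: polyfun_ext bP => x; rewrite bc.
Qed.

Lemma localization_sum (I : Type) (r : seq I) (F : I -> T -> k) :
  (forall i, localization (F i)) ->
  localization (fun x => \sum_(i <- r) F i x).
Proof.
move=> FP; elim: r => [|i r IH].
  apply: localization_ext (localization_polyfun (polyfun_cst u 0)) => x.
  by rewrite big_nil.
by apply: localization_ext (localizationD (FP i) IH) => x; rewrite big_cons.
Qed.

Lemma localizationM b c : localization b -> localization c ->
  localization (fun x => b x * c x).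
Proof.
move=> [N bP] [M cP]; exists (N + M)%N.
by apply: polyfun_ext (polyfunM bP cP) => x; rewrite exprD mulrACA.
Qed.

Lemma localizationX b m :
  localization b -> localization (fun x => b x ^+ m).
Proof.
move=> bP; elim: m => [|m IH]; first exact: localization_polyfun (polyfun_cst u 1).
by apply: localization_ext (localizationM bP IH) => x; rewrite exprS.
Qed.

Lemma localization_prod (I : Type) (r : seq I) (F : I -> T -> k) :
  (forall i, localization (F i)) ->
  localization (fun x => \prod_(i <- r) F i x).
Proof.
move=> FP; elim: r => [|i r IH].
  apply: localization_ext (localization_polyfun (polyfun_cst u 1)) => x.
  by rewrite big_nil.
by apply: localization_ext (localizationM (FP i) IH) => x; rewrite big_cons.
Qed.

Lemma localization_trans m (c : T -> 'rV[k]_m) f :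
  (forall i, localization (fun x => c x 0 i)) -> polyfun c f ->
  localization f.
Proof.
move=> cP [p fE]; have : localization
    (fun x => \sum_(m <- msupp p) p@_m * \prod_i c x 0 i ^+ m i).
  apply: localization_sum => l; apply: localizationM.
    exact/localization_polyfun/polyfun_cst.
  by apply: localization_prod => i; apply: localizationX.
by apply: localization_ext => x; rewrite fE mevalE.
Qed.

End Localization.

(** * Regular functions and connectedness *)

Section RegularFunctions.

Variables (k : fieldType) (G : affine_algebraic_group k).

Local Notation co := (av_coord (aag_variety G)).

Definition regular (f : G -> k) := polyfun co f.

(** Morphisms from the variety G to itself, such as translations and inversion; in general they are
    not group homomorphisms. *)
Definition endomorphic (phi : G -> G) :=
  forall i, regular (fun x => co (phi x) 0 i).

Lemma regular_comp phi f :
  endomorphic phi -> regular f -> regular (fun x => f (phi x)).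
Proof. by move=> phiP fP; apply: polyfun_trans phiP (polyfun_comp phi fP). Qed.

Lemma endomorphic_id : endomorphic id.
Proof. by move=> i; apply: polyfun_coord. Qed.

Lemma endomorphic_cst g : endomorphic (fun=> g).
Proof. by move=> i; apply: polyfun_cst. Qed.

Lemma endomorphic_mul phi psi :
  endomorphic phi -> endomorphic psi -> endomorphic (fun x => phi x * psi x)%g.
Proof.
move=> phiP psiP i; have [F FE] := aag_mul_morphism G.
apply: (polyfun_trans (polyfun_row_mx phiP psiP)).
by exists (F i) => x; rewrite -(FE (phi x, psi x)).
Qed.

Lemma endomorphic_inv phi :
  endomorphic phi -> endomorphic (fun x => (phi x)^-1)%g.
Proof.
move=> phiP i; have [F FE] := aag_inv_morphism G.
by apply: (polyfun_trans phiP); exists (F i) => x; rewrite -FE.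
Qed.

Lemma regular_translate f : regular f ->
  exists (t : nat) (a b : 'I_t -> G -> k),
    [/\ forall j, regular (a j), forall j, regular (b j) &
        forall g x, f (g * x)%g = \sum_j a j g * b j x].
Proof.
move=> fP; have [F FE] := aag_mul_morphism G.
have [|t [a [b [aP bP E]]]] :=
  @polyfun_separated _ _ _ _ _ co co (fun z => f (z.1 * z.2)%g).
  apply: polyfun_trans (polyfun_comp (fun z => z.1 * z.2)%g fP) => i.
  by exists (F i) => z; rewrite -FE.
by exists t, a, b; split=> // g x; rewrite -E.
Qed.

(* A form of Zariski connectedness that passes easily to commutator subgroups. *)
Definition rigid (H : G -> Prop) :=
  forall f (s : seq k), regular f -> (forall x, H x -> f x \in s) ->
  forall x y, H x -> H y -> f x = f y.

(** The fibre of [f] over [f x] and the union of its fibres over the other values in [s] are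
    disjoint closed sets covering G. The first contains [x], so the second is empty. *)
Lemma rigid_connected : is_connected (aag_variety G) -> rigid (fun=> True).
Proof.
case=> _ conn f s fP fs x y _ _.
have closed0 h : regular h -> closed_in (aag_variety G) (fun z => h z = 0).
  move=> [q hE]; exists (fun v => q.@[v 0] = 0); split; last by move=> z; rewrite hE.
  by exists (eq q) => v; split=> [q0 _ <-|->].
have cP c : regular (fun z => f z - c).
  exact: polyfunD fP (polyfun_cst _ _).
have [|||||] := conn (fun z => f z - f x = 0)
  (fun z => \prod_(c <- s | c != f x) (f z - c) = 0).
- exact: closed0.
- by apply: closed0; apply: polyfun_prod => c _; apply: cP.
- move=> z; have [/eqP ->|neq] := boolP (f z == f x); first by left; rewrite subrr.
  right; apply/eqP; rewrite prodf_seq_eq0.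
  by apply/hasP; exists (f z); rewrite ?fs ?neq ?subrr /=.
- move=> z [/eqP + /eqP]; rewrite subr_eq0 prodf_seq_eq0 => /eqP->.
  by case/hasP=> c _ /andP[/negPf neq]; rewrite subr_eq0 eq_sym neq.
- by move/(_ x); rewrite subrr.
move=> /(_ y) nB; have [/eqP->//|neq] := boolP (f y == f x).
case: nB; apply/eqP; rewrite prodf_seq_eq0.
by apply/hasP; exists (f y); rewrite ?fs ?neq ?subrr /=.
Qed.

(* x |-> c [x, y] is a morphism taking the value c at 1, so a finite-valued
   function is invariant under right multiplication by commutators. *)
Lemma rigid_derived (H : G -> Prop) :
  H 1%g -> rigid H -> rigid (@derived_subgroup G H).
Proof.
move=> H1 rH f s fP fs.
have inv d : derived_subgroup H d ->
    forall c, derived_subgroup H c -> f (c * d)%g = f c.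
  elim=> [x y Hx Hy c dc|c _|x y dx IHx dy IHy c dc|x dx IH c dc].
  - pose phi z := (c * [~ z, y])%g.
    have phiP : endomorphic phi.
      have [iP yP] := (endomorphic_id, endomorphic_cst y).
      apply: (endomorphic_mul (endomorphic_cst c)).
      apply: (endomorphic_mul (endomorphic_inv iP)).
      exact: (endomorphic_mul (endomorphic_inv yP) (endomorphic_mul iP yP)).
    rewrite -[RHS](congr1 f (_ : phi 1%g = c)); last by rewrite /phi comm1g mulg1.
    apply: (rH (fun z => f (phi z)) s) => // [|z Hz]; first exact: regular_comp.
    by apply: fs; apply: derived_mul dc _; apply: derived_comm.
  - by rewrite mulg1.
  - by rewrite mulgA IHy ?IHx //; apply: derived_mul.
  - have dxV := derived_inv dx.
    by rewrite -(IH (c * x^-1)%g) ?mulgVK //; apply: derived_mul.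
have one z : derived_subgroup H z -> f z = f 1%g.
  by move=> dz; rewrite -[z in LHS]mul1g inv //; apply: derived_one.
by move=> x y dx dy; rewrite !one.
Qed.

End RegularFunctions.

(** * The Lie-Kolchin theorem *)

(** Among the spaces lying in every space that contains [Q], one of maximal rank absorbs each vector
    of [Q], since adding the vector cannot raise the rank. *)
Lemma span_exists (k : fieldType) n (Q : 'rV[k]_n -> Prop) :
  exists W : 'M[k]_n, (forall u, Q u -> (u <= W)%MS) /\
    forall m (E : 'M[k]_(m, n)), (forall u, Q u -> (u <= E)%MS) -> (W <= E)%MS.
Proof.
pose small (W : 'M[k]_n) := forall m (E : 'M[k]_(m, n)),
  (forall u, Q u -> (u <= E)%MS) -> (W <= E)%MS.
have [||_ [[W sW ->] maxW]] := @ex_maxnat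
  (fun r => exists2 W, small W & r = \rank W) n.
- by exists 0%N, 0; rewrite ?mxrank0 // => m E _; apply: sub0mx.
- by move=> _ [W _ ->]; apply: rank_leq_col.
exists W; split=> // u Qu.
have sWu : small (W + u)%MS by move=> m E QE; rewrite addsmx_sub sW ?QE.
have le := maxW _ (ex_intro2 _ _ _ sWu erefl).
apply: submx_trans (addsmxSr W u) _.
by rewrite -(mxrank_leqif_sup (addsmxSl W u)) eqn_leq le mxrankS ?addsmxSl.
Qed.

(** * Eigenvectors over an algebraically closed field *)

Section Eigenvectors.

Variable k : closedFieldType.

Lemma eigenvector_in_stable n (A W : 'M[k]_n) :
  W != 0 -> stablemx W A ->
  exists (v : 'rV_n) (a : k), [/\ v != 0, (v <= W)%MS & v *m A = a *: v].
Proof.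
move=> W0 WA; pose R := row_base W.
have Rfree : row_free R by apply: row_base_free.
have [a] : exists a, eigenvalue (conjmx R A) a.
  have /closed_rootP [a ra] : size (char_poly (conjmx R A)) != 1%N.
    by rewrite size_char_poly eqSS mxrank_eq0.
  by exists a; rewrite eigenvalue_root_char.
case/eigenvalueP=> v vA v0; exists (v *m R), a; split.
- by rewrite mulmx_free_eq0.
- by rewrite (submx_trans (submxMl _ _)) ?eq_row_base.
rewrite scalemxAl -vA /conjmx -mulmxA -[RHS]mulmxA mulmxKpV //.
by rewrite stablemx_row_base.
Qed.

(** On a nonzero common stable subspace [W] of minimal rank each [A] is scalar: an eigenspace of [A]
    meeting [W] nontrivially cuts out a subspace that is stable by commutation, hence equal to
    [W]. *)
Lemma common_eigenvector n (F : 'M[k]_n -> Prop) : (0 < n)%N ->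
  (forall A B, F A -> F B -> A *m B = B *m A) ->
  exists2 v : 'rV_n, v != 0 & forall A, F A -> exists a, v *m A = a *: v.
Proof.
move=> n0 comm.
have [|_ [[W [W0 WF ->]] minW]] := @ex_minnat (fun r => exists W : 'M[k]_n,
  [/\ W != 0, forall A, F A -> stablemx W A & r = \rank W]).
  exists n, 1%:M; split; rewrite ?mxrank1 // -?mxrank_eq0 ?mxrank1 -?lt0n //.
  by move=> A _; apply: stableCmx.
exists (nz_row W); first by rewrite nz_row_eq0.
move=> A FA; have [v [a [v0 vW vA]]] := eigenvector_in_stable W0 (WF A FA).
exists a; apply/eigenspaceP.
suff: (W <= eigenspace A a)%MS by apply: submx_trans (nz_row_sub _).
pose E := (W :&: eigenspace A a)%MS.
have vE : (v <= E)%MS by rewrite sub_capmx vW; apply/eigenspaceP.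
suff: (W <= E)%MS by rewrite sub_capmx => /andP[].
have EW : (E <= W)%MS by apply: capmxSl.
rewrite -(mxrank_leqif_sup EW) eqn_leq mxrankS //= leqNgt; apply/negP=> ltE.
apply: (minW _ ltE); exists E; split=> //.
  by apply: contraNneq v0 => E0; rewrite -submx0 -E0.
move=> B FB; rewrite sub_capmx.
rewrite (submx_trans (submxMr _ (capmxSl _ _))) ?WF //=.
apply: submx_trans (submxMr _ (capmxSr _ _)) _.
by apply: comm_mx_stable_eigenspace; apply: comm.
Qed.

Lemma eigenvalues_finite n (A : 'M[k]_n) :
  exists s : seq k, forall a, eigenvalue A a -> a \in s.
Proof.
have [s E] := closed_field_poly_normal (char_poly A); exists s => a.
rewrite eigenvalue_root_char E (monicP (char_poly_monic A)) scale1r.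
by rewrite root_prod_XsubC.
Qed.

Lemma unity_roots_finite n : (0 < n)%N ->
  exists s : seq k, forall a, a ^+ n = 1 -> a \in s.
Proof.
move=> n0; have [s E] := closed_field_poly_normal ('X^n - 1 : {poly k}).
exists s => a an1; rewrite -root_prod_XsubC.
have : root ('X^n - 1) a by rewrite /root !hornerE an1 subrr.
rewrite {1}E rootZ // lead_coef_eq0 -size_poly_eq0.
by rewrite size_XnsubC.
Qed.

End Eigenvectors.

Section LieKolchin.

Variables (k : closedFieldType) (G : affine_algebraic_group k).
Hypothesis Grigid : rigid (fun _ : G => True).

Record regular_rep n (rho : G -> 'M[k]_n) : Prop := RegularRep {
  rep1 : rho 1%g = 1%:M;
  repM : forall g h, rho (g * h)%g = rho g *m rho h;
  rep_regular : forall i j, regular (fun g => rho g i j)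
}.

Lemma repVK n (rho : G -> 'M[k]_n) g : regular_rep rho ->
  rho g^-1%g *m rho g = 1%:M.
Proof. by move=> rhoP; rewrite -(repM rhoP) mulVg rep1. Qed.

Definition irreducible_rep n (rho : G -> 'M[k]_n) :=
  forall W : 'M[k]_n, (forall g, stablemx W (rho g)) -> W = 0 \/ row_full W.

Definition acts_by_scalars n (rho : G -> 'M[k]_n) (H : G -> Prop) :=
  forall h, H h -> is_scalar_mx (rho h).

(** The determinant is multiplicative with commuting values, so it is trivial on commutators. *)
Lemma det_derived n (rho : G -> 'M[k]_n) (H : G -> Prop) h :
  regular_rep rho -> derived_subgroup H h -> \det (rho h) = 1.
Proof.
move=> rhoP; have detM g g' : \det (rho (g * g')%g) = \det (rho g) * \det (rho g').
  by rewrite (repM rhoP) det_mulmx.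
have det1 : \det (rho 1%g) = 1 by rewrite (rep1 rhoP) det1.
have detV g : \det (rho g^-1%g) * \det (rho g) = 1 by rewrite -detM mulVg.
elim=> // [x y _ _|x y _ dx _ dy|x _ dx].
- rewrite /commg /conjg !detM mulrA mulrACA.
  by rewrite !detV mulr1.
- by rewrite detM dx dy mulr1.
- by have := detV x; rewrite dx mulr1.
Qed.

(* If [H, H] acts by scalars, these have determinant 1, so they are n-th roots
   of unity, and are 1 by rigidity: H acts through commuting matrices.  The
   eigencharacter of a common eigenvector is then invariant under conjugation by
   the rigid group G, since it takes values among the eigenvalues of one matrix. *)
Lemma acts_by_scalars_derived n (rho : G -> 'M[k]_n) (H : G -> Prop) :
  (0 < n)%N -> regular_rep rho -> irreducible_rep rho ->
  H 1%g -> (forall g h, H h -> H (g * h * g^-1)%g) ->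
  rigid (derived_subgroup H) ->
  acts_by_scalars rho (derived_subgroup H) -> acts_by_scalars rho H.
Proof.
case: n rho => // n rho _ rhoP irr H1 HJ rD scalD.
have [s sP] := unity_roots_finite k (ltn0Sn n).
have D1 d : derived_subgroup H d -> rho d = 1%:M.
  move=> Dd; have sc d' : derived_subgroup H d' -> rho d' = (rho d' 0 0)%:M.
    by move=> /scalD/is_scalar_mxP[a ->]; rewrite mxE eqxx.
  rewrite (sc d Dd) (rD (fun g => rho g 0 0) s _ _ d 1%g) //.
  - by rewrite (rep1 rhoP) mxE eqxx.
  - exact: rep_regular.
  - by move=> d' Dd'; apply: sP; rewrite -det_scalar -sc // (det_derived rhoP Dd').
  - exact: derived_one.
have commH A B : (exists2 h, H h & A = rho h) -> (exists2 h, H h & B = rho h) ->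
    A *m B = B *m A.
  move=> [x Hx ->] [y Hy ->]; rewrite -!(repM rhoP).
  have ->: (x * y = y * x * [~ x, y])%g.
    by rewrite /commg /conjg !mulgA mulgK mulgV mul1g.
  by rewrite (repM rhoP) (D1 [~ x, y]%g) ?mulmx1 //; apply: derived_comm.
have [v v0 vP] := common_eigenvector (ltn0Sn n) commH.
have [j vj] : exists j, v 0 j != 0 by apply/rV0Pn.
(* The eigenvalue is read off at a coordinate where [v] is nonzero, which makes [chi] a regular
   function on all of G. *)
pose chi h := (v *m rho h) 0 j / v 0 j.
have chiE h : H h -> v *m rho h = chi h *: v.
  move=> Hh; have [|a E] := vP (rho h); first by exists h.
  by rewrite E /chi E mxE mulfK.
have eigen g h : H h ->
    (v *m rho g) *m rho h = chi (g * h * g^-1)%g *: (v *m rho g).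
  move=> Hh; rewrite scalemxAl -(chiE _ (HJ g h Hh)) -!mulmxA -!(repM rhoP).
  by rewrite mulgVK.
have vg0 g : v *m rho g != 0.
  apply: contraNneq v0 => vg0; rewrite -(mulmx1 v) -(rep1 rhoP) -(mulgV g).
  by rewrite (repM rhoP) mulmxA vg0 mul0mx.
have chiJ g h : H h -> chi (g * h * g^-1)%g = chi h.
  move=> Hh; have [t tP] := eigenvalues_finite (rho h).
  have -> : chi h = chi (1 * h * 1^-1)%g by rewrite invg1 mulg1 mul1g.
  apply: (Grigid (f := fun z => chi (z * h * z^-1)%g) (s := t)) => //.
    apply: (@regular_comp _ _ (fun z => z * h * z^-1)%g chi).
      have iP := @endomorphic_id k G.
      exact: endomorphic_mul (endomorphic_mul iP (endomorphic_cst h))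
                             (endomorphic_inv iP).
    apply: polyfunM (polyfun_cst _ _); apply: (@polyfun_ext _ _ _ _
      (fun z => \sum_i v 0 i * rho z i j)) => [z|]; first by rewrite mxE.
    apply: polyfun_sum => i _; apply: polyfunM (polyfun_cst _ _) _.
    exact: rep_regular.
  by move=> z _; apply: tP; apply/eigenvalueP; exists (v *m rho z); rewrite ?eigen.
(* [W] is the span of the G-orbit of [v]. It is stable and nonzero, hence everything by
   irreducibility, and [h] acts on each generator by the same scalar [chi h]. *)
have [W [vW minW]] := span_exists (fun u => exists g, u = v *m rho g).
have [g|W0|Wfull h Hh] := irr W.
(* Each generator [v *m rho x] is the image under [rho g^-1] of the generator [v *m rho (x * g)];
   multiplying the inclusion by [rho g] then gives stability. *)
- have : (W <= W *m rho g^-1%g)%MS.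
    apply: minW => _ [x ->]; rewrite -(mulmx1 (v *m rho x)) -(rep1 rhoP) -(mulgV g).
    rewrite (repM rhoP) mulmxA submxMr // -mulmxA -(repM rhoP); apply: vW.
    by exists (x * g)%g.
  move=> /(submxMr (rho g)); rewrite -mulmxA repVK // mulmx1 => ?.
  exact: submx_trans (submxMr _ _) _.
- have := vW (v *m rho 1%g); rewrite W0 submx0 (negPf (vg0 _)).
  by move=> F; have // := F (ex_intro _ _ erefl).
apply/is_scalar_mxP; exists (chi h).
have : (W <= eigenspace (rho h) (chi h))%MS.
  by apply: minW => _ [g ->]; apply/eigenspaceP; rewrite eigen // chiJ.
move: Wfull; rewrite -sub1mx => Wf /(submx_trans Wf)/eigenspaceP.
by rewrite mul1mx scalemx1.
Qed.

Lemma iter_derived_normal i :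
  iter i (@derived_subgroup G) (fun=> True) 1%g /\
  forall g h, iter i (@derived_subgroup G) (fun=> True) h ->
    iter i (@derived_subgroup G) (fun=> True) (g * h * g^-1)%g.
Proof.
elim: i => [//|i [IH1 IHJ]]; split; first exact: derived_one.
have JE (x y : G) : (x * y * x^-1 = y ^ x^-1)%g by rewrite conjgE invgK mulgA.
move=> g h; elim=> [x y Hx Hy||x y _ dx _ dy|x _ dx]; rewrite JE.
- by rewrite conjRg; apply: derived_comm; rewrite -JE; apply: IHJ.
- by rewrite conj1g; apply: derived_one.
- by rewrite conjMg; apply: derived_mul; rewrite -JE.
- by rewrite conjVg; apply: derived_inv; rewrite -JE.
Qed.

Lemma iter_derived_rigid i : rigid (iter i (@derived_subgroup G) (fun=> True)).
Proof.
elim: i => [|i IH]; first exact: Grigid.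
by have [H1 _] := iter_derived_normal i; apply: (rigid_derived H1).
Qed.

Hypothesis Gsolv : solvable_group G.

(** Some term of the derived series is trivial and so acts by scalars; [acts_by_scalars_derived]
    climbs the series from there back to G. *)
Lemma irreducible_scalar n (rho : G -> 'M[k]_n) : (0 < n)%N ->
  regular_rep rho -> irreducible_rep rho -> acts_by_scalars rho (fun=> True).
Proof.
move=> n0 rhoP irr; have [d Dd] := Gsolv.
have : acts_by_scalars rho (iter d (@derived_subgroup G) (fun=> True)).
  by move=> h /Dd ->; rewrite (rep1 rhoP) scalar_mx_is_scalar.
elim: d {Dd} => //= d IH scal; apply: IH.
have [H1 HJ] := iter_derived_normal d.
apply: acts_by_scalars_derived => //.
exact: (@iter_derived_rigid d.+1).
Qed.

(** Induction on [n]: in the irreducible case G acts by scalars and any nonzero vector will do;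
    otherwise an eigenvector is found in a proper nonzero stable subspace. *)
Theorem lie_kolchin n (rho : G -> 'M[k]_n) : (0 < n)%N -> regular_rep rho ->
  exists2 v : 'rV_n, v != 0 & forall g, exists a, v *m rho g = a *: v.
Proof.
elim/ltn_ind: n rho => n IH rho n0 rhoP.
have [irr|] := classic (irreducible_rep rho).
  exists (const_mx 1).
    by apply/rV0Pn; exists (Ordinal n0); rewrite mxE oner_eq0.
  move=> g; have /is_scalar_mxP[a ->] := irreducible_scalar n0 rhoP irr (h := g) I.
  by exists a; rewrite mul_mx_scalar.
move=> /not_all_ex_not[W red].
have [stW [W0 ltW]] : (forall g, stablemx W (rho g)) /\ W <> 0 /\ ~ row_full W.
  by split; [|split]; apply: NNPP; tauto.
have [R [Rfree stR]] :
    exists R : 'M_(\rank W, n), row_free R /\ forall g, stablemx R (rho g).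
  by exists (row_base W); split=> [|g]; rewrite ?row_base_free ?stablemx_row_base.
pose sigma g := conjmx R (rho g).
have sigmaR g : sigma g *m R = R *m rho g by rewrite /sigma /conjmx mulmxKpV.
have [|||v v0 vP] := IH (\rank W) _ sigma.
- by rewrite ltn_neqAle rank_leq_col andbT; apply/negP.
- by rewrite lt0n mxrank_eq0; apply/eqP.
- split=> [|g h|i j].
  + by apply: (row_free_inj Rfree); rewrite /= sigmaR (rep1 rhoP) mulmx1 mul1mx.
  + apply: (row_free_inj Rfree); rewrite /= sigmaR (repM rhoP) -mulmxA sigmaR.
    by rewrite !mulmxA sigmaR.
  apply: (@polyfun_ext _ _ _ _ (fun g =>
    \sum_l (\sum_m R i m * rho g m l) * pinvmx R l j)) => [g|].
    by rewrite /sigma /conjmx mxE; apply: eq_bigr => l _; rewrite [(R *m _) i l]mxE.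
  apply: polyfun_sum => l _; apply: polyfunM (polyfun_cst _ _).
  apply: polyfun_sum => m _; apply: polyfunM (polyfun_cst _ _) _.
  exact: rep_regular.
exists (v *m R); first by rewrite mulmx_free_eq0.
move=> g; have [a E] := vP g; exists a.
by rewrite -mulmxA -sigmaR mulmxA E scalemxAl.
Qed.

End LieKolchin.

(** * The triangular module of coordinates *)

Section TriangularModule.

Variables (k : closedFieldType) (G : affine_algebraic_group k).

Lemma regular_mulmx m n p (A : G -> 'M[k]_(m, n)) (B : G -> 'M[k]_(n, p)) :
  (forall i j, regular (fun g => A g i j)) ->
  (forall i j, regular (fun g => B g i j)) ->
  forall i j, regular (fun g => (A g *m B g) i j).
Proof.
move=> AP BP i j.
apply: (@polyfun_ext _ _ _ _ (fun g => \sum_l A g i l * B g l j)) => [g|].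
  by rewrite mxE.
apply: polyfun_sum => l _; apply: polyfunM; [exact: AP|exact: BP].
Qed.

Lemma regular_rep_conj n (rho : G -> 'M[k]_n) P : P \in unitmx ->
  regular_rep rho -> regular_rep (fun g => P *m rho g *m invmx P).
Proof.
move=> Pu rhoP; split=> [|g h|].
- by rewrite (rep1 rhoP) mulmx1 mulmxV.
- by rewrite (repM rhoP) !mulmxA mulmxKV.
apply: regular_mulmx => [|i j]; last exact: polyfun_cst.
apply: regular_mulmx => [i j|]; first exact: polyfun_cst.
exact: rep_regular.
Qed.

(** The rank factorization writes [v] as a scalar times (1, 0, ..., 0) times the invertible
    [row_ebase v], whose first row is therefore proportional to [v]. *)
Lemma extend_row (K : fieldType) n (v : 'rV[K]_(1 + n)) : v != 0 ->
  exists2 Q : 'M_(1 + n), Q \in unitmx & exists c, usubmx Q = c *: v.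
Proof.
move=> v0; exists (row_ebase v); first exact: row_ebase_unit.
have rv : \rank v = 1%N by apply/eqP; rewrite eqn_leq rank_leq_row lt0n mxrank_eq0.
exists (invmx (col_ebase v) 0 0).
have pidE : (pid_mx 1 : 'M[K]_(1, 1 + n)) = row_mx 1%:M 0.
  apply/matrixP=> i j; rewrite [RHS]mxE mxE ord1.
  case: (splitP j) => l ->; rewrite ?ord1 !mxE ?eqxx //.
have := mulKmx (col_ebase_unit v) (pid_mx (\rank v) *m row_ebase v).
rewrite (mulmxA (col_ebase v)) mulmx_ebase rv pidE -{1}[row_ebase v]vsubmxK mul_row_col.
rewrite mul1mx mul0mx addr0 => <-.
by rewrite {1}[invmx _]mx11_scalar mul_scalar_mx.
Qed.

(** A common eigenvector taken as first basis row makes every matrix block lower triangular; the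
    lower right block is again a representation, to which the induction applies. *)
Lemma triangularizable (Grigid : rigid (fun _ : G => True))
    (Gsolv : solvable_group G) n (rho : G -> 'M[k]_n) : regular_rep rho ->
  exists2 P : 'M[k]_n, P \in unitmx &
    forall g, is_trig_mx (P *m rho g *m invmx P).
Proof.
elim: n rho => [|n IH] rho rhoP.
  by exists 1%:M; rewrite ?unitmx1 // => g; apply/is_trig_mxP => -[].
have [v v0 vP] := lie_kolchin Grigid Gsolv (ltn0Sn n) rhoP.
have [Q Qu [c Qv]] := @extend_row _ n v v0.
pose sigma g : 'M_(1 + n) := Q *m rho g *m invmx Q.
have sigmaP : regular_rep sigma := regular_rep_conj Qu rhoP.
have QE g : Q *m rho g = sigma g *m Q by rewrite mulmxKV.
have ur0 g : ursubmx (sigma g) = 0.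
  have [a va] := vP g; rewrite /ursubmx -!mul_usub_mx Qv -scalemxAl va.
  rewrite scalerA mulrC -scalerA -Qv -scalemxAl mul_usub_mx mulmxV //.
  by rewrite scalar_mx_block /block_mx col_mxKu scale_row_mx row_mxKr scaler0.
have sigmaE g : sigma g =
    block_mx (ulsubmx (sigma g)) 0 (dlsubmx (sigma g)) (drsubmx (sigma g)).
  by rewrite -{1}[sigma g]submxK ur0.
have [|P Pu Ptrig] := IH (fun g => drsubmx (sigma g)).
  split=> [|g h|i j].
  - by rewrite (rep1 sigmaP) scalar_mx_block block_mxKdr.
  - rewrite (repM sigmaP) {1}[sigma g]sigmaE {1}[sigma h]sigmaE mulmx_block.
    by rewrite block_mxKdr mulmx0 add0r.
  apply: (@polyfun_ext _ _ _ _ (fun g => sigma g (rshift 1 i) (rshift 1 j))) => [g|].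
    by rewrite !mxE.
  exact: rep_regular.
pose D : 'M_(1 + n) := block_mx 1%:M 0 0 P.
have Du : D \in unitmx.
  by rewrite unitmxE det_ublock det1 mul1r -unitmxE.
exists (D *m Q); first by rewrite unitmx_mul Du.
move=> g; pose T : 'M_(1 + n) := block_mx (ulsubmx (sigma g)) 0
  (P *m dlsubmx (sigma g)) (P *m drsubmx (sigma g) *m invmx P).
have -> : D *m Q *m rho g *m invmx (D *m Q) = T.
  rewrite -(mulmxA D) QE sigmaE mulmxA mulmx_block.
  rewrite !mul0mx !mulmx0 !mul1mx !addr0 !add0r.
  have -> : block_mx (ulsubmx (sigma g)) 0 (P *m dlsubmx (sigma g))
                     (P *m drsubmx (sigma g)) = T *m D.
    by rewrite mulmx_block !mulmx0 !mul0mx !mulmx1 !addr0 !add0r mulmxKV.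
  by rewrite -(mulmxA T) mulmxK // unitmx_mul Du.
rewrite [is_trig_mx _](@is_trig_block_mx _ 1 n 1 n) //.
by rewrite eqxx mx11_is_trig Ptrig.
Qed.

(* (e, p) selects a maximal nonsingular minor of the evaluation matrix phi i x. *)
Lemma finite_rank_basis (K : fieldType) (I T : Type) (phi : I -> T -> K)
    (J : finType) (a : I -> J -> K) (b : J -> T -> K) :
  (forall i x, phi i x = \sum_j a i j * b j x) ->
  exists (n : nat) (e : 'I_n -> I) (p : 'I_n -> T) (D : 'M[K]_n),
    (\matrix_(r, s) phi (e r) (p s)) *m D = 1%:M /\
    forall i x, phi i x =
      \sum_r (\sum_s phi i (p s) * D s r) * phi (e r) x.
Proof.
move=> phiE; pose minor n (e : 'I_n -> I) (p : 'I_n -> T) := \matrix_(r, s) phi (e r) (p s).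
have [||n [[e [p eu]] maxn]] := @ex_maxnat (fun n => exists e p, minor n e p \in unitmx) #|J|.
- exists 0%N, (fun i : 'I_0 => match notF (ltn_ord i) with end).
  exists (fun i : 'I_0 => match notF (ltn_ord i) with end).
  by rewrite unitmxE det_mx00 unitr1.
(* Every such matrix factors through a space of dimension [#|J|], which bounds the size of the
   nonsingular ones. *)
- move=> n [e [p eu]]; have -> : n = \rank (minor n e p) by rewrite mxrank_unit.
  have -> : minor n e p = (\matrix_(r < n, s < #|J|) a (e r) (enum_val s)) *m
                          (\matrix_(r < #|J|, s < n) b (enum_val r) (p s)).
    apply/matrixP=> r s; rewrite !mxE phiE (reindex _ (onW_bij _ (@enum_val_bij J))) /=.
    by apply: eq_bigr => l _; rewrite !mxE.
  exact: leq_trans (mxrankM_maxl _ _) (rank_leq_col _).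
set M := minor n e p in eu; exists n, e, p, (invmx M); split.
  exact: mulmxV.
(* If the expansion failed at [i] and [x], bordering [M] with this row and column would give a
   larger nonsingular minor: the Schur complement is the difference of the two sides. *)
move=> i x; apply/eqP; rewrite -subr_eq0; apply/negP=> /negP neq0.
pose c := \col_r phi (e r) x; pose r := \row_s phi i (p s).
pose d := (phi i x)%:M : 'M[K]_1.
pose e' (j : 'I_(n + 1)) := if split j is inl l then e l else i.
pose p' (j : 'I_(n + 1)) := if split j is inl l then p l else x.
suff u' : minor (n + 1)%N e' p' \in unitmx.
  by have := maxn (n + 1)%N (ex_intro _ e' (ex_intro _ p' u')); rewrite addn1 ltnn.
have -> : minor (n + 1)%N e' p' = block_mx M c r d.
  apply/matrixP=> s t; rewrite mxE /e' /p'.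
  case: (split_ordP s) => s' ->; case: (split_ordP t) => t' ->.
  - by rewrite block_mxEul mxE.
  - by rewrite block_mxEur mxE.
  - by rewrite block_mxEdl mxE.
  - by rewrite block_mxEdr mxE !ord1.
have -> : block_mx M c r d = block_mx 1%:M 0 (r *m invmx M) 1%:M *m
    block_mx M c 0 (d - r *m invmx M *m c).
  rewrite mulmx_block !mul1mx !mul0mx !addr0 mulmxKV //.
  by rewrite addrC subrK.
rewrite unitmxE det_mulmx det_lblock !det1 mul1r mul1r det_ublock unitrM -unitmxE eu.
rewrite det_mx11 unitfE; suff -> : (d - r *m invmx M *m c) 0 0 =
    phi i x - \sum_r (\sum_s phi i (p s) * invmx M s r) * phi (e r) x by [].
rewrite !mxE mulr1n; congr (_ - _); apply: eq_bigr => l _.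
by rewrite !mxE; congr (_ * _); apply: eq_bigr => m _; rewrite mxE.
Qed.

Local Notation co := (av_coord (aag_variety G)).

Lemma regular_left_translate f g :
  regular f -> regular (fun x : G => f (g * x)%g).
Proof.
apply: regular_comp => //.
exact: endomorphic_mul (endomorphic_cst g) (@endomorphic_id k G).
Qed.

(** By [regular_translate] the left translates of the coordinates span a space of finite dimension;
    [v] is a basis of it made of translates. *)
Lemma finite_module_of_coordinates :
  exists (n : nat) (v : G -> 'cV[k]_n) (rho : G -> 'M[k]_n),
    [/\ regular_rep rho, forall i, regular (fun x => v x i 0),
        forall g x, v (g * x)%g = rho g *m v x &
        forall i, exists r : 'rV_n, forall x, co x 0 i = (r *m v x) 0 0].
Proof.
pose phi (z : 'I_(av_dim (aag_variety G)) * G) (x : G) := co (z.2 * x)%g 0 z.1.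
have coP i : regular (fun x : G => co x 0 i) by apply: polyfun_coord.
have /fin_all_exists[t /fin_all_exists[a /fin_all_exists[b abP]]] i :=
  regular_translate (coP i).
pose J := {i : 'I_(av_dim (aag_variety G)) & 'I_(t i)}.
have [|n [e [p [D [MD phiE]]]]] := @finite_rank_basis k _ _ phi J
  (fun z j => if tag j == z.1 then a (tag j) (tagged j) z.2 else 0)
  (fun j x => b (tag j) (tagged j) x).
  move=> [i g] x; have [_ _ /= E] := abP i; rewrite /phi /= E.
  transitivity (\sum_i' \sum_(j < t i')
      (if i' == i then a i' j g else 0) * b i' j x); last by rewrite sig_big_dep.
  rewrite (bigD1 i) //= eqxx [X in _ + X]big1 ?addr0 // => i' /negPf->.
  by apply: big1 => j _; rewrite mul0r.
pose v x : 'cV[k]_n := \col_r phi (e r) x.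
(* Row [r] expands the translate by [g] of the basis function [r]. The evaluation points [p s] are
   independent of [g], so the coefficients are regular in [g]. *)
pose rho g : 'M[k]_n := \matrix_(r, r')
  \sum_s phi ((e r).1, (e r).2 * g)%g (p s) * D s r'.
have vE g x : v (g * x)%g = rho g *m v x.
  apply/matrixP=> r j; rewrite !mxE /phi mulgA -/(phi (_, _) x) phiE.
  by apply: eq_bigr => r' _; rewrite !mxE.
pose V := \matrix_(r, s) phi (e r) (p s).
(* The evaluation matrix [V] is invertible, so a matrix is determined by its products with the
   vectors [v x]; this turns [vE] into the laws of a representation. *)
have colV A B : (forall x, A *m v x = B *m v x) -> A = B.
  move=> AB; rewrite -[A]mulmx1 -[B]mulmx1 -MD !mulmxA; congr (_ *m _).
  apply/matrixP=> r s.
  have colE C : (C *m V) r s = (C *m v (p s)) r 0.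
    by rewrite !mxE; apply: eq_bigr => l _; rewrite !mxE.
  by rewrite !colE AB.
exists n, v, rho; split=> [|r|//|i].
- split=> [|g h|r s].
  + by apply: colV => x; rewrite -vE !mul1g mul1mx.
  + by apply: colV => x; rewrite -mulmxA -!vE mulgA.
  apply: (@polyfun_ext _ _ _ _ (fun g =>
      \sum_l co ((e r).2 * g * p l)%g 0 (e r).1 * D l s)) => [g|].
    by rewrite mxE.
  apply: polyfun_sum => l _; apply: polyfunM (polyfun_cst _ _).
  apply: (@regular_comp _ _ (fun g => (e r).2 * g * p l)%g
    (fun x => co x 0 (e r).1)) => //.
  have iP := @endomorphic_id k G.
  exact: endomorphic_mul (endomorphic_mul (endomorphic_cst _) iP) (endomorphic_cst _).
- apply: (@polyfun_ext _ _ _ _ (phi (e r))) => [x|]; first by rewrite mxE.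
  exact: (regular_left_translate (e r).2 (coP (e r).1)).
exists (\row_r \sum_s phi (i, 1%g) (p s) * D s r) => x.
rewrite mxE -[x in LHS]mul1g -/(phi (i, 1%g) x) phiE.
by apply: eq_bigr => r _; rewrite !mxE.
Qed.

Lemma triangular_module_of_coordinates (Grigid : rigid (fun _ : G => True))
    (Gsolv : solvable_group G) :
  exists (n : nat) (v : 'I_n -> G -> k) (T : 'I_n -> 'I_n -> G -> k),
    [/\ forall j, regular (v j), forall i j, regular (T i j),
        forall g x j, v j (g * x)%g = \sum_l T j l g * v l x,
        forall (j l : 'I_n) g, (j < l)%N -> T j l g = 0 &
        [/\ forall j, T j j 1%g = 1,
            forall g h j, T j j (g * h)%g = T j j g * T j j h &
        forall i, exists c, forall x, co x 0 i = \sum_j c j * v j x]].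
Proof.
have [n [v [rho [rhoP vP vE coE]]]] := finite_module_of_coordinates.
have [P Pu trig] := triangularizable Grigid Gsolv rhoP.
pose T g := P *m rho g *m invmx P; pose w x := P *m v x.
have TP : regular_rep T := regular_rep_conj Pu rhoP.
have wE g x : w (g * x)%g = T g *m w x by rewrite /w vE /T !mulmxA mulmxKV.
have T0 (j l : 'I_n) g : (j < l)%N -> T g j l = 0 by move: j l; apply/is_trig_mxP/trig.
exists n, (fun j x => w x j 0), (fun j l g => T g j l).
split=> [j||g x j|//|]; [|exact: rep_regular| |split=> [j|g h j|i]].
- by apply: regular_mulmx => i l; [apply: polyfun_cst|rewrite ord1; apply: vP].
- by rewrite wE mxE.
- by rewrite (rep1 TP) mxE eqxx.
- rewrite (repM TP) mxE (bigD1 j) //= big1 ?addr0 // => l.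
  rewrite neq_ltn => /orP[lt|lt]; first by rewrite (T0 l j) ?mulr0.
  by rewrite (T0 j l) ?mul0r.
have [r E] := coE i; exists (fun j => (r *m invmx P) 0 j) => x.
transitivity ((r *m invmx P *m w x) 0 0); last by rewrite mxE.
by rewrite /w mulmxA mulmxKV // E.
Qed.

End TriangularModule.

(** * Adjoining an element to a simple algebra *)

Section TranslationStableAlgebras.

Variables (k : fieldType) (G : groupType).
Implicit Types (B J : (G -> k) -> Prop) (f b : G -> k).

Record left_stable_algebra B : Prop := LeftStableAlgebra {
  lsa_cst : forall a, B (fun=> a);
  lsaD : forall b c, B b -> B c -> B (fun x => b x + c x);
  lsaM : forall b c, B b -> B c -> B (fun x => b x * c x);
  lsa_translate : forall g b, B b -> B (fun x => b (g * x)%g)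
}.

Record left_stable_ideal B J : Prop := LeftStableIdeal {
  lsi_sub : forall b, J b -> B b;
  lsiD : forall b c, J b -> J c -> J (fun x => b x + c x);
  lsiM : forall b c, B b -> J c -> J (fun x => b x * c x);
  lsi_translate : forall g b, J b -> J (fun x => b (g * x)%g)
}.

(** Substitute for a field of coefficients: applied to ideals of leading coefficients, it yields
    monic polynomials without division. *)
Definition left_simple B := forall J, left_stable_ideal B J ->
  forall b, J b -> (exists x, b x != 0) -> J (fun=> 1).

Lemma lsa_sum B (I : Type) (r : seq I) (F : I -> G -> k) :
  left_stable_algebra B -> (forall i, B (F i)) ->
  B (fun x => \sum_(i <- r) F i x).
Proof.
move=> alg BF; elim: r => [|i r IH].
  have -> : (fun x => \sum_(i <- [::]) F i x) = (fun=> 0).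
    by apply: functional_extensionality => x; rewrite big_nil.
  exact: lsa_cst.
have -> : (fun x => \sum_(j <- i :: r) F j x) =
          (fun x => F i x + \sum_(j <- r) F j x).
  by apply: functional_extensionality => x; rewrite big_cons.
exact: lsaD.
Qed.

(** * Coefficients under a shift of the variable *)

Section ShiftedPolynomials.

Implicit Types p : {poly k}.

Lemma coef_comp_XaddC p c d : (size p <= d.+1)%N ->
  (p \Po ('X + c%:P))`_d = p`_d.
Proof.
rewrite leq_eqVlt => /orP[/eqP sp|lt].
  have := @lead_coef_comp _ p ('X + c%:P).
  rewrite size_XaddC lead_coefXaddC expr1n mulr1 => /(_ isT).
  by rewrite /lead_coef size_comp_poly2 ?size_XaddC // sp.
by rewrite !nth_default ?size_comp_poly2 ?size_XaddC.
Qed.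

Lemma coef_XaddC_exp (c : k) d : (('X + c%:P) ^+ d.+1)`_d = c *+ d.+1.
Proof.
elim: d => [|d IH]; first by rewrite expr1 coefD coefX coefC add0r.
rewrite exprS mulrDl coefD coefXM coefCM IH [RHS]mulrSr; congr (_ + _).
have sz : size (('X + c%:P) ^+ d.+1) = d.+2.
  by rewrite -[c]opprK polyCN size_exp_XsubC.
have := monicP (monic_exp d.+1 (monicXaddC c)); rewrite /lead_coef.
by rewrite sz => ->; rewrite mulr1.
Qed.

(** Once ['X^(d.+1)] is split off, the rest has degree at most [d] and keeps its coefficient there;
    the power contributes [c *+ d.+1]. *)
Lemma coef_pred_comp_XaddC p c d : p \is monic -> size p = d.+2 ->
  (p \Po ('X + c%:P))`_d = p`_d + c *+ d.+1.
Proof.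
move=> pm sp.
have pd : p`_d.+1 = 1 by have := monicP pm; rewrite /lead_coef sp.
have r_le : (size (p - 'X^(d.+1))%R <= d.+1)%N.
  apply/leq_sizeP => j; rewrite leq_eqVlt => /orP[/eqP<-|lt].
    by rewrite coefB coefXn eqxx pd subrr.
  by rewrite coefB coefXn gtn_eqF // nth_default ?subr0 // sp.
rewrite -[p in LHS](subrK 'X^(d.+1)) comp_polyD comp_Xn_poly coefD coef_XaddC_exp coef_comp_XaddC //.
by rewrite coefB coefXn ltn_eqF // subr0.
Qed.

End ShiftedPolynomials.

Variable B : (G -> k) -> Prop.
Hypotheses (Balg : left_stable_algebra B) (Bsimple : left_simple B).

(** An element of B[X], encoded as a family of polynomials over [k] indexed by the points of G. *)
Definition poly_family (q : G -> {poly k}) :=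
  (exists d, forall x, (size (q x) <= d)%N) /\ forall i, B (fun x => (q x)`_i).

Variable P : G -> G -> k.
Hypothesis BP : forall g, B (P g).

(* The action of g on polynomials in f, when f (g x) = f x + P g x. *)
Definition twist g (q : G -> {poly k}) x := q (g * x)%g \Po ('X + (P g x)%:P).

Lemma size_twist g (q : G -> {poly k}) d : (forall x, (size (q x) <= d)%N) ->
  forall x, (size (twist g q x) <= d)%N.
Proof. by move=> le x; rewrite size_comp_poly2 ?size_XaddC. Qed.

Lemma poly_family_twist g q : poly_family q -> poly_family (twist g q).
Proof.
case=> [[d le] Bq]; split; first by exists d; apply: size_twist.
have BX m i : B (fun x => (('X + (P g x)%:P) ^+ m)`_i).
  elim: m i => [|m IH] i.
    have -> : (fun x => (('X + (P g x)%:P) ^+ 0)`_i) = (fun=> (i == 0%N)%:R).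
      by apply: functional_extensionality => x; rewrite coef1.
    exact: lsa_cst.
  have -> : (fun x => (('X + (P g x)%:P) ^+ m.+1)`_i) =
      (fun x => (if i is j.+1 then (('X + (P g x)%:P) ^+ m)`_j else 0) +
                P g x * (('X + (P g x)%:P) ^+ m)`_i).
    apply: functional_extensionality => x.
    by rewrite exprS mulrDl coefD coefXM coefCM; case: i.
  apply: lsaD => //; last exact: lsaM.
  by case: i => [|i]; [apply: lsa_cst|apply: IH].
move=> i; have -> : (fun x => (twist g q x)`_i) =
    (fun x => \sum_(j < d) (q (g * x)%g)`_j * (('X + (P g x)%:P) ^+ j)`_i).
  apply: functional_extensionality => x; rewrite coef_comp_poly.
  rewrite (big_ord_widen d (fun j => (q (g * x)%g)`_j * (('X + (P g x)%:P) ^+ j)`_i)) //.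
  rewrite big_mkcond; apply: eq_bigr => j _; case: ltnP => // ge.
  by rewrite nth_default ?mul0r.
apply: lsa_sum => // j; apply: lsaM => //.
exact: (lsa_translate Balg g (Bq j)).
Qed.

(* Leading coefficients of the elements of minimal degree form a stable ideal
   of B, so some such element is monic; it is fixed by all twists, since the
   differences have lower degree. *)
Lemma monic_twist_invariant (J : (G -> {poly k}) -> Prop) q0 x0 :
  (forall q, J q -> poly_family q) ->
  (forall q r, J q -> J r -> J (fun x => q x + r x)) ->
  (forall b q, B b -> J q -> J (fun x => b x *: q x)) ->
  (forall g q, J q -> J (twist g q)) ->
  J q0 -> q0 x0 != 0 ->
  exists q d, [/\ J q, forall x, q x \is monic, forall x, size (q x) = d.+1 &
                  forall g x, twist g q x = q x].
Proof.
move=> JB JD JZ Jt Jq0 q0nz.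
have [|m [[q1 [Jq1 le1 [x1 nz1]]] minm]] := @ex_minnat (fun m => exists q,
    [/\ J q, forall x, (size (q x) <= m)%N & exists x, q x != 0]).
  by have [[d le] _] := JB _ Jq0; exists d, q0; split=> //; exists x0.
case: m le1 minm => [|d] le1 minm.
  by have := le1 x1; rewrite leqn0 size_poly_eq0 (negPf nz1).
have small q : J q -> (forall x, (size (q x) <= d)%N) -> forall x, q x = 0.
  move=> Jq le x; apply/eqP; have [//|nz] := boolP (q x == 0).
  by case: (minm d (ltnSn d)); exists q; split=> //; exists x.
pose L c := exists q, [/\ J q, forall x, (size (q x) <= d.+1)%N &
                         c = fun x => (q x)`_d].
have Lideal : left_stable_ideal B L.
  split=> [_ [q [Jq _ ->]]|_ _ [q [Jq leq ->]] [r [Jr ler ->]]|b c Bb|g c].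
  - exact: (JB q Jq).2.
  - exists (fun x => q x + r x); split=> [|x|]; first exact: JD.
      by rewrite (leq_trans (size_polyD _ _)) // geq_max leq ler.
    by apply: functional_extensionality => x; rewrite coefD.
  - case=> q [Jq leq ->]; exists (fun x => b x *: q x); split=> [|x|]; first exact: JZ.
      exact: leq_trans (size_scale_leq _ _) _.
    by apply: functional_extensionality => x; rewrite coefZ.
  case=> q [Jq leq ->]; exists (twist g q); split; [exact: Jt|exact: size_twist|].
  by apply: functional_extensionality => x; rewrite coef_comp_XaddC.
have [||q [Jq leq q1E]] := Bsimple Lideal (b := fun x => (q1 x)`_d).
- by exists q1.
- apply: NNPP => no; case/eqP: nz1; apply: small => // x; apply/leq_sizeP => j.
  rewrite leq_eqVlt => /orP[/eqP<-|lt]; last by rewrite nth_default // (leq_trans (le1 x)).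
  by apply/eqP; have [//|nz] := boolP ((q1 x)`_d == 0); case: no; exists x.
have qd x : (q x)`_d = 1 by rewrite -[1]/((fun=> 1) x) q1E.
have sq x : size (q x) = d.+1.
  apply/eqP; rewrite eqn_leq leq ltnNge; apply/negP => le.
  by have := qd x; rewrite nth_default // => /esym/eqP; rewrite oner_eq0.
exists q, d; split=> // [x|g x]; first by rewrite monicE /lead_coef sq qd.
pose r y := twist g q y + (-1) *: q y.
have Jr : J r by apply: JD; [exact: Jt|exact: (JZ (fun=> -1) q (lsa_cst Balg (-1)) Jq)].
apply/eqP; rewrite -subr_eq0 -scaleN1r; apply/eqP.
apply: (small r Jr) => y; apply/leq_sizeP => j.
rewrite leq_eqVlt coefD coefZ mulN1r => /orP[/eqP<-|lt].
  by rewrite coef_comp_XaddC ?qd ?subrr ?leq.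
by rewrite !nth_default ?subrr // ?sq // size_twist // => z; rewrite sq.
Qed.

Lemma poly_familyC b : B b -> poly_family (fun x => (b x)%:P).
Proof.
move=> Bb; split; first by exists 1%N => x; apply: size_polyC_leq1.
case=> [|i].
  have -> : (fun x => (b x)%:P`_0) = b.
    by apply: functional_extensionality => x; rewrite coefC.
  exact: Bb.
have -> : (fun x => (b x)%:P`_i.+1) = (fun=> 0).
  by apply: functional_extensionality => x; rewrite coefC.
exact: lsa_cst.
Qed.

Lemma poly_familyD q r :
  poly_family q -> poly_family r -> poly_family (fun x => q x + r x).
Proof.
move=> [[d led] Bq] [[e lee] Br]; split=> [|i].
  exists (maxn d e) => x; apply: leq_trans (size_polyD _ _) _.
  by rewrite geq_max !leq_max led lee orbT.
have -> : (fun x => (q x + r x)`_i) = (fun x => (q x)`_i + (r x)`_i).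
  by apply: functional_extensionality => x; rewrite coefD.
exact: lsaD.
Qed.

Lemma poly_familyZ b q :
  B b -> poly_family q -> poly_family (fun x => b x *: q x).
Proof.
move=> Bb [[d led] Bq]; split=> [|i].
  by exists d => x; apply: leq_trans (size_scale_leq _ _) _.
have -> : (fun x => (b x *: q x)`_i) = (fun x => b x * (q x)`_i).
  by apply: functional_extensionality => x; rewrite coefZ.
exact: lsaM.
Qed.

Variable f : G -> k.
Hypothesis fP : forall g x, f (g * x)%g = f x + P g x.
Hypothesis nBf : ~ B f.
Hypothesis char0 : [pchar k] =i pred0.

Definition adjoin (h : G -> k) :=
  exists2 q, poly_family q & forall x, h x = (q x).[f x].

Lemma horner_twist g q x : (twist g q x).[f x] = (q (g * x)%g).[f (g * x)%g].
Proof. by rewrite horner_comp !hornerE fP. Qed.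

(** A nonzero relation would yield a monic one fixed by all twists. Degree zero is impossible, and
    in positive degree the second coefficient would put [f] in [B]. *)
Lemma adjoin_free q : poly_family q -> (forall x, (q x).[f x] = 0) ->
  forall x, q x = 0.
Proof.
move=> Fq q0 x0; apply/eqP; have [//|nz] := boolP (q x0 == 0).
pose J r := poly_family r /\ forall x, (r x).[f x] = 0.
have [|||||r [d [[Fr r0] rm sr rt]]] := monic_twist_invariant (J := J) _ _ _ _ _ nz.
- by move=> r [].
- move=> r s [Fr r0] [Fs s0]; split=> [|x]; first exact: poly_familyD.
  by rewrite hornerD r0 s0 addr0.
- move=> b r Bb [Fr r0]; split=> [|x]; first exact: poly_familyZ.
  by rewrite hornerZ r0 mulr0.
- move=> g r [Fr r0]; split=> [|x]; first exact: poly_family_twist.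
  by rewrite horner_twist r0.
- by [].
case: d sr => [|e] sr.
  have := r0 1%g; have /eqP/size_poly1P[c c0 E] := sr 1%g.
  by rewrite E hornerC => /eqP; rewrite (negPf c0).
(* The coefficients just below the leading one are compared. At [x = 1] this gives [P g 1], that is
   [f g - f 1], in terms of that coefficient after division by [e.+1]. *)
have E g x : (r (g * x)%g)`_e + P g x *+ e.+1 = (r x)`_e.
  by rewrite -[in RHS](rt g x) /twist coef_pred_comp_XaddC.
case: nBf; have e0 : e.+1%:R != 0 :> k by rewrite ((pcharf0P k).1 char0).
have -> : f = (fun x => f 1%g + e.+1%:R^-1 * ((r 1%g)`_e + (-1) * (r x)`_e)).
  apply: functional_extensionality => x; rewrite -[x in LHS]mulg1 fP; congr (_ + _).
  rewrite -(E x 1%g) mulg1 mulN1r addrAC subrr add0r -[P x _ *+ _]mulr_natl mulKf //.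
have [_ Br] := Fr.
apply: (lsaD Balg (lsa_cst Balg (f 1%g))).
apply: (lsaM Balg (lsa_cst Balg _)).
apply: (lsaD Balg (lsa_cst Balg _)).
exact: (lsaM Balg (lsa_cst Balg (-1)) (Br e)).
Qed.

(** Among the polynomials whose value at [f] lies in the ideal there is a monic one fixed by all
    twists. Its value at [f] is translation-invariant, hence a constant, and nonzero by
    [adjoin_free]. *)
Lemma adjoin_simple : left_simple adjoin.
Proof.
move=> J Jideal h Jh [x0 h0].
have JE b c : b =1 c -> J b -> J c by move=> /functional_extensionality ->.
have [q0 Fq0 hE] := lsi_sub Jideal Jh.
pose J' r := poly_family r /\ J (fun x => (r x).[f x]).
have [||||||r [d [[Fr Jr] rm sr rt]]] :=
    monic_twist_invariant (J := J') (q0 := q0) (x0 := x0).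
- by move=> r [].
- move=> r s [Fr Jr] [Fs Js]; split; first exact: poly_familyD.
  by apply: JE (lsiD Jideal Jr Js) => x; rewrite hornerD.
- move=> b r Bb [Fr Jr]; split; first exact: poly_familyZ.
  have Ab : adjoin b.
    by exists (fun x => (b x)%:P) => [|x]; [apply: poly_familyC|rewrite hornerC].
  by apply: JE (lsiM Jideal Ab Jr) => x; rewrite hornerZ.
- move=> g r [Fr Jr]; split; first exact: poly_family_twist.
  by apply: JE (lsi_translate Jideal g Jr) => x; rewrite horner_twist.
- by split=> //; apply: JE Jh.
- by apply: contraNneq h0 => q00; rewrite hE q00 horner0.
pose c := (r 1%g).[f 1%g].
have rE x : (r x).[f x] = c.
  by rewrite -[x in LHS]mulg1 -horner_twist rt.
have c0 : c != 0.
  apply/eqP => c0; have rx0 : r 1%g = 0.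
    by apply: adjoin_free => // x; rewrite rE.
  by have := sr 1%g; rewrite rx0 size_poly0.
have Ac : adjoin (fun=> c^-1).
  exists (fun=> c^-1%:P) => [|x]; last by rewrite hornerC.
  by apply: (@poly_familyC (fun=> c^-1)); apply: lsa_cst.
by apply: JE (lsiM Jideal Ac Jr) => x; rewrite rE mulVf.
Qed.

End TranslationStableAlgebras.

Lemma left_simple_ext (k : fieldType) (G : groupType) (B B' : (G -> k) -> Prop) :
  (forall b, B b <-> B' b) -> left_simple B -> left_simple B'.
Proof.
move=> BB' simple J [J1 J2 J3 J4]; apply: simple; split=> // [b Jb|b c Bb Jc].
  by apply/BB'/J1.
by apply: J3 => //; apply/BB'.
Qed.

(** * Charts *)

Section Charts.

Variables (k : fieldType) (G : affine_algebraic_group k).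
Hypothesis char0 : [pchar k] =i pred0.

Local Notation co := (av_coord (aag_variety G)).

(** The invariant kept while functions are adjoined: [chart_translate] yields the action on affine
    space, [chart_free] extends identities from G to that space, and [chart_simple] permits the next
    adjunction. *)
Record chart n (u : G -> 'rV[k]_n) (w : G -> k) : Prop := Chart {
  chart_regular : forall i, regular (fun x => u x 0 i);
  chart_den : polyfun u w;
  chart_denM : forall g h, w (g * h)%g = w g * w h;
  chart_den_neq0 : forall x, w x != 0;
  chart_translate : forall i,
    polyfun (fun z : G * G => row_mx (co z.1) (u z.2))
            (fun z => u (z.1 * z.2)%g 0 i);
  chart_free : forall p : {mpoly k[n]}, (forall x, p.@[u x 0] = 0) -> p = 0;
  chart_simple : left_simple (localization u w)
}.

Lemma chart_translate_fixed n (u : G -> 'rV[k]_n) w g i : chart u w ->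
  polyfun u (fun x => u (g * x)%g 0 i).
Proof.
move=> uw.
apply: polyfun_trans (polyfun_comp (fun x => (g, x)) (chart_translate uw i)).
by apply: polyfun_row_mx => j /=; [apply: polyfun_cst|apply: polyfun_coord].
Qed.

(** As [w] is multiplicative, translating a denominator only multiplies it by a nonzero constant. *)
Lemma chart_algebra n (u : G -> 'rV[k]_n) w : chart u w ->
  left_stable_algebra (localization u w).
Proof.
move=> uw; have wP := chart_den uw; split=> [a|b c|b c|g b [N bP]].
- exact/localization_polyfun/polyfun_cst.
- exact: localizationD.
- exact: localizationM.
exists N; have bgP : polyfun u (fun x => w (g * x)%g ^+ N * b (g * x)%g).
  apply: polyfun_trans (polyfun_comp (fun x => g * x)%g bP) => i.
  exact: chart_translate_fixed uw.
apply: polyfun_ext (polyfunM (polyfun_cst u (w g ^- N)) bgP) => x.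
rewrite (chart_denM uw) exprMn -!mulrA mulKf //.
by rewrite expf_neq0 ?(chart_den_neq0 uw).
Qed.

(* Grouping the monomials of p by the exponent of the last variable. *)
Lemma mpoly_last_coef (K : fieldType) n (p : {mpoly K[n + 1]}) :
  exists (d : nat) (c : nat -> {mpoly K[n]}),
    (forall (v : 'rV[K]_n) (a : 'rV[K]_1),
       p.@[row_mx v a 0] = \sum_(e < d) (c e).@[v 0] * a 0 0 ^+ e) /\
    ((forall e, (e < d)%N -> c e = 0) -> p = 0).
Proof.
pose l : 'I_(n + 1) := rshift n 0.
pose r (m : 'X_{1..n + 1}) : 'X_{1..n} := [multinom m (lshift 1 i) | i < n].
pose d := (\max_(m <- msupp p) (m l).+1)%N.
pose c e := \sum_(m <- msupp p | m l == e) p@_m *: 'X_[r m].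
have led m : m \in msupp p -> (m l < d)%N.
  by move=> mp; rewrite /d (big_rem m) //= leq_maxl.
exists d, c; split=> [v a|c0].
  rewrite mevalE.
  transitivity (\sum_(e < d) \sum_(m <- msupp p | m l == e)
      p@_m * \prod_i row_mx v a 0 i ^+ m i).
    rewrite (exchange_big_dep predT) //=; apply: eq_big_seq => m mp.
    by rewrite (big_pred1 (Ordinal (led m mp))).
  apply: eq_bigr => e _; rewrite raddf_sum mulr_suml.
  apply: eq_bigr => m /eqP me; rewrite /= mevalZ mevalX -mulrA; congr (_ * _).
  rewrite big_split_ord big_ord1 /= row_mxEr me; congr (_ * _).
  by apply: eq_bigr => i _; rewrite row_mxEl mnmE.
apply/eqP; rewrite -msupp_eq0; apply/eqP; case E: (msupp p) => [//|m s].
have mp : m \in msupp p by rewrite E mem_head.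
have rl (m' : 'X_{1..n + 1}) : m' l == m l -> r m' = r m -> m' = m.
  move=> /eqP el er; apply/mnmP => i; case: (split_ordP i) => j ->.
    by have := congr1 (fun q : 'X_{1..n} => q j) er; rewrite !mnmE.
  by rewrite ord1.
have := congr1 (fun q : {mpoly K[n]} => q@_(r m)) (c0 (m l) (led m mp)).
rewrite mcoeff0 raddf_sum /= (big_rem m) //= eqxx mcoeffZ mcoeffX eqxx mulr1.
rewrite big1_seq ?addr0 => [|m' /andP[el]].
  by move/eqP; rewrite mcoeff_eq0 mp.
rewrite mem_rem_uniq ?msupp_uniq // inE => /andP[neq _].
rewrite mcoeffZ mcoeffX; case: eqP => [er|_]; last by rewrite mulr0.
by rewrite (rl m') ?eqxx in neq.
Qed.

(** The new variable is [w ^+ M * f], with [M] clearing the denominators of all [b j]. Since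
    k[u'][1/w] is k[u][1/w][f], independence and simplicity come from [adjoin_free] and
    [adjoin_simple]. *)
Lemma chart_extend n (u : G -> 'rV[k]_n) w f
    (t : nat) (c b : 'I_t -> G -> k) :
  chart u w -> regular f ->
  (forall j, regular (c j)) -> (forall j, localization u w (b j)) ->
  (forall g x, f (g * x)%g = f x + \sum_j c j g * b j x) ->
  exists n' (u' : G -> 'rV[k]_n'),
    [/\ chart u' w, forall h, localization u w h -> localization u' w h &
        localization u' w f].
Proof.
move=> uw fP cP bP fE; have [Bf|nBf] := classic (localization u w f).
  by exists n, u.
have wP := chart_den uw; have w0 := chart_den_neq0 uw.
have Balg := chart_algebra uw.
have [M bMP] : exists M, forall j, polyfun u (fun x => w x ^+ M * b j x).
  have /fin_all_exists[N NP] := bP; exists (\max_j N j)%N => j.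
  by apply: localization_le (NP j) _ _ => //; apply: leq_bigmax.
pose P g x := \sum_j c j g * b j x.
have BP g : localization u w (P g).
  by apply: lsa_sum => // j; apply: (lsaM Balg (lsa_cst Balg _)).
pose u' x : 'rV[k]_(n + 1) := row_mx (u x) (\row__ (w x ^+ M * f x)).
have uu' h : polyfun u h -> polyfun u' h.
  apply: polyfun_trans => i; apply: polyfun_ext (polyfun_coord u' (lshift 1 i)) => x.
  by rewrite row_mxEl.
have loc h : localization u w h -> localization u' w h.
  by case=> N hP; exists N; apply: uu'.
have wfP : polyfun u' (fun x => w x ^+ M * f x).
  apply: polyfun_ext (polyfun_coord u' (rshift n 0)) => x.
  by rewrite row_mxEr mxE.
have locf : localization u' w f by exists M.
have wreg : regular w by apply: polyfun_trans wP; apply: chart_regular uw.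
exists (n + 1)%N, u'; split=> //.
(* A polynomial in [u'] is read as a polynomial in [f]; the power [e] of the last variable
   contributes the factor [w ^+ (M * e)] to the coefficient. *)
have famE (p : {mpoly k[n + 1]}) : exists (d : nat) (c' : nat -> {mpoly k[n]}),
    [/\ poly_family (localization u w)
          (fun x => \poly_(e < d) ((c' e).@[u x 0] * w x ^+ (M * e))),
        forall x, p.@[u' x 0] =
          (\poly_(e < d) ((c' e).@[u x 0] * w x ^+ (M * e))).[f x] &
        (forall e, (e < d)%N -> c' e = 0) -> p = 0].
  have [d [c' [pE p0]]] := mpoly_last_coef p; exists d, c'; split=> // [|x].
    split; first by exists d => x; apply: size_poly.
    move=> i; have [lt|ge] := ltnP i d.
      apply: localization_ext (localization_polyfun _ _) => [x|].
        by rewrite coef_poly lt.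
      by apply: polyfunM (polyfunX _ wP); exists (c' i).
    apply: localization_ext (lsa_cst Balg 0) => x.
    by rewrite coef_poly ltnNge ge.
  rewrite pE (horner_coef_wide _ (size_poly _ _)).
  apply: eq_bigr => e _; rewrite coef_poly ltn_ord -mulrA; congr (_ * _).
  by rewrite mxE exprMn exprM.
have adjE h : adjoin (localization u w) f h <-> localization u' w h.
  split=> [[q [[d led] Bq] hE]|[N [p pE]]].
    have : localization u' w (fun x => \sum_(i < d) (q x)`_i * f x ^+ i).
      apply: localization_sum => [|i]; first exact: uu'.
      apply: localizationM; first exact: loc.
      by apply: localizationX.
    by apply: localization_ext => x; rewrite hE (horner_coef_wide _ (led x)).
  have [d [c' [Fq qE _]]] := famE p.
  have wN : localization u w (fun x => w x ^- N).
    exists N; apply: polyfun_ext (polyfun_cst u 1) => x.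
    by rewrite mulfV ?expf_neq0.
  exists (fun x => w x ^- N *:
    \poly_(e < d) ((c' e).@[u x 0] * w x ^+ (M * e))) => [|x].
    exact: (poly_familyZ Balg wN Fq).
  by rewrite hornerZ -qE -pE mulKf ?expf_neq0.
split.
- move=> i; case: (split_ordP i) => j ->.
    by apply: polyfun_ext (chart_regular uw j) => x; rewrite row_mxEl.
  have : regular (fun x => w x ^+ M * f x) by apply: polyfunM (polyfunX M wreg) fP.
  by apply: polyfun_ext => x; rewrite row_mxEr mxE.
- exact: uu'.
- exact: chart_denM uw.
- by [].
- pose R (z : G * G) := row_mx (co z.1) (u' z.2).
  move=> i; case: (split_ordP i) => j ->.
    have : polyfun R (fun z => u (z.1 * z.2)%g 0 j).
      apply: polyfun_trans (chart_translate uw j).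
      apply: polyfun_row_mx => l; first exact: polyfun_fst (polyfun_coord co l).
      exact: polyfun_snd (uu' _ (polyfun_coord u l)).
    by apply: polyfun_ext => z; rewrite row_mxEl.
  (* Translation splits [w ^+ M] into a factor in [z.1] and a factor in [z.2]; the latter is
     absorbed by [f] and by each [b l]. *)
  have : polyfun R (fun z => w z.1 ^+ M * (w z.2 ^+ M * f z.2) +
      \sum_l w z.1 ^+ M * c l z.1 * (w z.2 ^+ M * b l z.2)).
    apply: polyfunD.
      by apply: polyfunM (polyfunX M (polyfun_fst _ wreg)) (polyfun_snd _ wfP).
    apply: polyfun_sum => l _; apply: polyfunM (polyfun_snd _ (uu' _ (bMP l))).
    exact: polyfunM (polyfunX M (polyfun_fst _ wreg)) (polyfun_fst _ (cP l)).
  apply: polyfun_ext => z; rewrite row_mxEr mxE fE (chart_denM uw) exprMn.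
  rewrite mulrDr mulrA mulr_sumr; congr (_ + _); apply: eq_bigr => l _.
  by rewrite mulrACA.
- move=> p pu'; have [d [c' [Fq qE p0]]] := famE p; apply: p0 => e lt.
  apply: (chart_free uw) => x.
  have q0 := adjoin_free Balg (chart_simple uw) BP fE nBf char0 Fq _ x.
  have := congr1 (fun r : {poly k} => r`_e) (q0 (fun y => etrans (esym (qE y)) (pu' y))).
  rewrite coef_poly lt coef0 => /eqP; rewrite mulf_eq0 expf_eq0 (negPf (w0 x)).
  by rewrite andbF orbF => /eqP.
- apply: (left_simple_ext adjE).
  exact: (adjoin_simple Balg (chart_simple uw) BP fE nBf char0).
Qed.

End Charts.

(** * The chart given by characters *)

Section Characters.

Variables (k : closedFieldType) (G : affine_algebraic_group k).
Hypothesis Grigid : rigid (fun _ : G => True).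

Local Notation co := (av_coord (aag_variety G)).

Record character (a : G -> k) : Prop := Character {
  character_regular : regular a;
  character1 : a 1%g = 1;
  characterM : forall g h, a (g * h)%g = a g * a h
}.

Lemma character_neq0 a x : character a -> a x != 0.
Proof.
move=> aP; apply/eqP=> ax0; have := characterM aP x x^-1%g.
by rewrite mulgV ax0 mul0r (character1 aP) => /eqP; rewrite oner_eq0.
Qed.

Lemma character_inv a : character a -> character (fun x => (a x)^-1).
Proof.
move=> aP; split=> [||g h]; last by rewrite (characterM aP) invfM.
  have : regular (fun x : G => a x^-1%g).
    apply: regular_comp (character_regular aP).
    exact: endomorphic_inv (@endomorphic_id k G).
  apply: polyfun_ext => x; apply: (mulIf (character_neq0 x aP)).
  by rewrite mulVf ?character_neq0 // -(characterM aP) mulVg (character1 aP).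
by rewrite (character1 aP) invr1.
Qed.

Lemma character_exp a n : character a -> character (fun x => a x ^+ n).
Proof.
move=> aP; split=> [||g h]; last by rewrite (characterM aP) exprMn.
  exact: polyfunX (character_regular aP).
by rewrite (character1 aP) expr1n.
Qed.

Lemma character_expz a (z : int) : character a -> character (fun x => a x ^ z).
Proof.
by move=> aP; case: z => n; [|apply: character_inv]; apply: character_exp.
Qed.

Definition laurent r (chi : 'I_r -> G -> k) (e : 'I_r -> int) x :=
  \prod_l chi l x ^ e l.

Lemma character_laurent r (chi : 'I_r -> G -> k) e :
  (forall l, character (chi l)) -> character (laurent chi e).
Proof.
move=> chiP; have zP l := character_expz (e l) (chiP l); split=> [||g h].
- by apply: polyfun_prod => l _; apply: character_regular (zP l).
- by apply: big1 => l _; apply: character1 (zP l).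
by rewrite -big_split; apply: eq_bigr => l _; apply: characterM (zP l) _ _.
Qed.

Lemma laurent_laurent r s (chi : 'I_r -> G -> k) (A : 'I_s -> 'I_r -> int) e x :
  (forall l, chi l x != 0) ->
  laurent (fun i => laurent chi (A i)) e x =
  laurent chi (fun l => \sum_i e i * A i l) x.
Proof.
move=> chi0; rewrite /laurent.
transitivity (\prod_i \prod_l chi l x ^ (e i * A i l)).
  apply: eq_bigr => i _; rewrite (big_morph _ (fun a b => expfzMl a b (e i)) (exp1rz _ (e i))).
  by apply: eq_bigr => l _; rewrite exprz_exp mulrC.
rewrite exchange_big; apply: eq_bigr => l _ /=.
rewrite (big_morph _ (fun a b => expfzDr a b (chi0 l)) (expr0z (chi l x))).
by [].
Qed.

(** The values are roots of unity of bounded order, hence finite in number, and rigidity makes the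
    character constant. *)
Lemma torsion_character a (z : int) : character a -> z != 0 ->
  (forall x, a x ^ z = 1) -> forall x, a x = 1.
Proof.
move=> aP z0 az x; have [n n0 an] : exists2 n, (0 < n)%N & forall y, a y ^+ n = 1.
  case: z z0 az => n z0 az; first by exists n => //; rewrite lt0n.
  by exists n.+1 => // y; apply/eqP; rewrite -invr_eq1; apply/eqP/az.
have [s sP] := unity_roots_finite k n0.
rewrite -(character1 aP); apply: (Grigid (s := s)) => // [|y _].
  exact: character_regular.
exact: sP.
Qed.

Definition multiplicatively_free r (chi : 'I_r -> G -> k) :=
  forall e, (forall x, laurent chi e x = 1) -> forall l, e l = 0.

(* A relation between generators is, after an invertible change of generators
   given by the Smith normal form, of the form psi_0 ^ d = 1; then psi_0 = 1 by
   rigidity, and a minimal generating family has no relation. *)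
Lemma free_characters n (a : 'I_n -> G -> k) : (forall j, character (a j)) ->
  exists r (chi : 'I_r -> G -> k), [/\ forall l, character (chi l),
    multiplicatively_free chi &
    forall j, exists e, forall x, a j x = laurent chi e x].
Proof.
move=> aP; pose gen r := exists chi : 'I_r -> G -> k,
  (forall l, character (chi l)) /\
  forall j, exists e, forall x, a j x = laurent chi e x.
have [|r [[chi [chiP chiE]] minr]] := @ex_minnat gen.
  exists n, a; split=> // j; exists (fun l => (l == j)%:R) => x.
  rewrite /laurent (bigD1 j) //= eqxx expr1z big1 ?mulr1 // => l /negPf->.
  by rewrite expr0z.
exists r, chi; split=> // e eP; apply: NNPP => e0.
case: r chi chiP chiE minr e eP e0 => [|r] chi chiP chiE minr e eP e0.
  by case: e0 => -[].
have [L Lu [R Ru [d _ E]]] := int_Smith_normal_form (\row_l e l).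
pose psi i := laurent chi (R i).
have psiP i : character (psi i) by apply: character_laurent.
have psiE f x : laurent psi f x = laurent chi (fun l => \sum_i f i * R i l) x.
  by rewrite laurent_laurent // => l; apply: character_neq0.
pose z := L 0 0 * d`_0.
(* The Smith form of a single row has one diagonal entry, so [e] is a multiple of the first row of
   the invertible [R]. *)
have eE l : e l = z * R 0 l.
  have := congr1 (fun A : 'M_(1, r.+1) => A 0 l) E; rewrite !mxE => ->.
  rewrite (bigD1 0) //= big1 ?addr0 => [|i i0]; rewrite !mxE big_ord1 !mxE /=.
    by rewrite mulr1n.
  by case: i i0 => -[|i] //= lt _; rewrite mulr0n mulr0 mul0r.
have z0 : z != 0.
  by apply: contra_notN e0 => /eqP z0 l; rewrite eE z0 mul0r.
have psi01 : forall x, psi 0 x = 1.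
  apply: (torsion_character (psiP 0) z0) => x; rewrite -(eP x).
  rewrite /psi /laurent (big_morph _ (fun a b => expfzMl a b z) (exp1rz _ z)).
  by apply: eq_bigr => l _; rewrite exprz_exp eE mulrC.
apply: (minr r (ltnSn r)); exists (fun l => psi (lift 0 l)); split=> // j.
have [f fE] := chiE j; pose h i := \sum_l f l * invmx R l i.
exists (fun l => h (lift 0 l)) => x; rewrite fE.
transitivity (laurent psi h x); last first.
  by rewrite /laurent big_ord_recl psi01 exp1rz mul1r.
rewrite psiE; congr (laurent _ _ _); apply: functional_extensionality => l.
have := congr1 (fun A : 'rV_r.+1 => A 0 l) (mulmxKV Ru (\row_l f l)).
rewrite !mxE => <-; apply: eq_bigr => i _; congr (_ * _).
by rewrite !mxE; apply: eq_bigr => m _; rewrite mxE.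
Qed.

(** * Monomials in independent characters *)

Section TorusChart.

Variables (r : nat) (chi : 'I_r -> G -> k).
Hypothesis chiP : forall l, character (chi l).
Hypothesis chi_free : multiplicatively_free chi.

Let u x : 'rV[k]_r := \row_l chi l x.
Let w x := \prod_l chi l x.

Let monomial (m : 'X_{1..r}) x := \prod_l chi l x ^+ m l.

(** Left translation by [g] on polynomials in the characters: monomials are eigenvectors. *)
Definition scale_monomials g (p : {mpoly k[r]}) :=
  \sum_(m <- msupp p) (p@_m * monomial m g) *: 'X_[m].

Lemma mevalX_characters m x : 'X_[m].@[u x 0] = monomial m x.
Proof. by rewrite mevalX; apply: eq_bigr => l _; rewrite mxE. Qed.

Lemma scale_monomialsE g p x :
  (scale_monomials g p).@[u x 0] = p.@[u (g * x)%g 0].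
Proof.
rewrite [RHS]mevalE /scale_monomials raddf_sum /=; apply: eq_bigr => m _.
rewrite mevalZ mevalX -mulrA -big_split; congr (_ * _).
apply: eq_bigr => l _; rewrite !mxE (characterM (chiP l)).
by rewrite exprMn.
Qed.

Lemma mcoeff_scale_monomials g p m :
  (scale_monomials g p)@_m = p@_m * monomial m g.
Proof.
rewrite /scale_monomials raddf_sum /=; have [mp|mp] := boolP (m \in msupp p).
  rewrite (bigD1_seq m) ?msupp_uniq //= mcoeffZ mcoeffX eqxx mulr1.
  rewrite big1 ?addr0 // => m' /negPf neq.
  by rewrite mcoeffZ mcoeffX neq mulr0.
rewrite (memN_msupp_eq0 mp) mul0r big1_seq // => m' /andP[_ m'p].
rewrite mcoeffZ mcoeffX; case: eqP => [em|_]; last by rewrite mulr0.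
by rewrite em (negPf mp) in m'p.
Qed.

(* Artin's independence argument, on an element of J with fewest monomials. *)
Lemma scale_stable_monomial (J : {mpoly k[r]} -> Prop) p0 :
  (forall p q, J p -> J q -> J (p + q)) -> (forall a p, J p -> J (a *: p)) ->
  (forall g p, J p -> J (scale_monomials g p)) ->
  J p0 -> p0 != 0 -> exists m, J 'X_[m].
Proof.
move=> JD JZ Js Jp0 p00.
have [|_ [[p [Jp pn0 ->]] minp]] :=
    @ex_minnat (fun n => exists p, [/\ J p, p != 0 & n = size (msupp p)]).
  by exists (size (msupp p0)), p0.
have [m0 m0p] : exists m0, m0 \in msupp p.
  move: pn0; rewrite -msupp_eq0; case: (msupp p) => // m s _.
  by exists m; rewrite mem_head.
exists m0; suff -> : 'X_[m0] = (p@_m0)^-1 *: p by apply: JZ.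
suff pE m : m \in msupp p -> m = m0.
  have pm0 : p@_m0 != 0 by rewrite -mcoeff_msupp.
  apply/mpolyP => m; rewrite mcoeffX mcoeffZ.
  have [<-|neq] := eqVneq m0 m; first by rewrite mulVf.
  rewrite (@memN_msupp_eq0 _ _ p m) ?mulr0 //; apply: contra neq => /pE ->.
  exact: eqxx.
(* The support of [q] lies in that of [p] with [m0] removed, so [q] vanishes by minimality and all
   monomials of [p] define the same character. *)
move=> mp; have eq_mon g : monomial m g = monomial m0 g.
  pose q := scale_monomials g p + (- monomial m0 g) *: p.
  have Jq : J q by apply: JD; [apply: Js|apply: JZ].
  have qE m' : q@_m' = p@_m' * (monomial m' g - monomial m0 g).
    by rewrite mcoeffD mcoeffZ mcoeff_scale_monomials mulrBr mulNr [monomial m0 g * _]mulrC.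
  have q0 : q = 0.
    apply/eqP; have [//|qn0] := boolP (q == 0).
    case: (minp (size (msupp q))); last by exists q.
    suff sub : {subset msupp q <= rem m0 (msupp p)}.
      apply: leq_ltn_trans (uniq_leq_size (msupp_uniq q) sub) _.
      by rewrite size_rem // prednK //; case: (msupp p) m0p.
    move=> m' m'q; rewrite mem_rem_uniq ?msupp_uniq // inE.
    move: m'q; rewrite mcoeff_msupp qE mulf_eq0 negb_or => /andP[].
    by rewrite -mcoeff_msupp => ->; rewrite andbT; apply: contra => /eqP->; rewrite subrr.
  have := qE m; rewrite q0 mcoeff0 => /esym/eqP.
  by rewrite mulf_eq0 mcoeff_eq0 mp /= subr_eq0 => /eqP.
(* The quotient of two equal monomials is a trivial Laurent monomial, so freeness forces equal
   exponents. *)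
apply/mnmP => l; have := chi_free (e := fun l => (m l)%:Z - (m0 l)%:Z) _ l.
have mon0 x : laurent chi (fun l => (m l)%:Z - (m0 l)%:Z) x = 1.
  transitivity (monomial m x / monomial m0 x); last first.
    rewrite eq_mon mulfV //; apply/prodf_neq0 => i _.
    by rewrite expf_neq0 ?character_neq0.
  rewrite /monomial -prodfV -big_split; apply: eq_bigr => i _ /=.
  by rewrite expfzDr ?character_neq0 // -exprnN.
by move=> /(_ mon0)/eqP; rewrite subr_eq0 => /eqP[].
Qed.

Lemma den_characters : polyfun u w.
Proof.
apply: polyfun_prod => l _.
by apply: polyfun_ext (polyfun_coord u l) => x; rewrite mxE.
Qed.

Lemma den_characters_neq0 x : w x != 0.
Proof. by apply/prodf_neq0 => l _; apply: character_neq0. Qed.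

Lemma localization_character l (z : int) :
  localization u w (fun x => chi l x ^ z).
Proof.
have pos : polyfun u (chi l).
  by apply: polyfun_ext (polyfun_coord u l) => x; rewrite mxE.
case: z => n; first exact: localization_polyfun (polyfunX n pos).
apply: (@localization_ext _ _ _ _ _ (fun x => (chi l x)^-1 ^+ n.+1)) => [x|].
  by rewrite exprVn.
(* The inverse of [chi l] is the product of the other characters divided by [w]. *)
apply: localizationX; exists 1%N.
apply: (@polyfun_ext _ _ _ _ (fun x => \prod_(i | i != l) chi i x)) => [x|].
  by rewrite expr1 /w [in RHS](bigD1 l) //= mulrAC mulfV ?mul1r ?character_neq0.
apply: polyfun_prod => i _.
by apply: polyfun_ext (polyfun_coord u i) => x; rewrite mxE.
Qed.

Lemma localization_laurent e : localization u w (laurent chi e).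
Proof.
by apply: localization_prod => l; apply: localization_character.
Qed.

(** Both the relations between the characters and the polynomials with values in a stable ideal are
    stable under [scale_monomials], so if nonzero they include a monomial. A monomial has no zeros,
    whence independence, and is invertible, whence simplicity. *)
Lemma torus_chart : chart u w.
Proof.
have wP := den_characters.
have mon_neq0 m x : monomial m x != 0.
  by apply/prodf_neq0 => l _; rewrite expf_neq0 ?character_neq0.
split=> [i||g h|x|i|p pu0|J Jideal b Jb [x0 bx0]].
- apply: polyfun_ext (character_regular (chiP i)) => x.
  by rewrite mxE.
- exact: wP.
- by rewrite -big_split; apply: eq_bigr => l _; apply: characterM.
- exact: den_characters_neq0.
- apply: polyfun_ext (polyfunM (polyfun_fst u (character_regular (chiP i)))
    (polyfun_snd co (polyfun_coord u i))) => z.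
  by rewrite !mxE (characterM (chiP i)).
- apply/eqP; have [//|pn0] := boolP (p == 0).
  have [p' q P Q x|a q Q x|g q Q x|m Jm] :=
    @scale_stable_monomial (fun p => forall x, p.@[u x 0] = 0) _ _ _ _ pu0 pn0.
  + by rewrite mevalD P Q addr0.
  + by rewrite mevalZ Q mulr0.
  + by rewrite scale_monomialsE.
  have := mon_neq0 m 1%g; rewrite -mevalX_characters Jm.
  by rewrite eqxx.
have JE c d : c =1 d -> J c -> J d by move=> /functional_extensionality ->.
have polyL q : localization u w (fun x => q.@[u x 0]).
  by apply: localization_polyfun; exists q.
have [N [p pE]] := lsi_sub Jideal Jb.
have Jp : J (fun x => p.@[u x 0]).
  apply: JE (lsiM Jideal (_ : localization u w (fun x => w x ^+ N)) Jb) => [x|].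
    by rewrite -pE.
  exact/localization_polyfun/polyfunX.
have pn0 : p != 0.
  have : w x0 ^+ N * b x0 != 0 by rewrite mulf_neq0 ?expf_neq0 ?den_characters_neq0.
  by apply: contraNneq => p0; rewrite pE p0 meval0.
have [q q' Jq Jq'|a q Jq|g q Jq|m Jm] :=
    @scale_stable_monomial (fun p => J (fun x => p.@[u x 0])) _ _ _ _ Jp pn0.
- by apply: JE (lsiD Jideal Jq Jq') => x; rewrite mevalD.
- apply: JE (lsiM Jideal (_ : localization u w (fun=> a)) Jq) => [x|].
    by rewrite mevalZ.
  exact/localization_polyfun/polyfun_cst.
- by apply: JE (lsi_translate Jideal g Jq) => x; rewrite scale_monomialsE.
apply: JE (lsiM Jideal (localization_laurent (fun l => - (m l)%:Z)) Jm) => x.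
rewrite mevalX_characters -big_split; apply: big1 => l _ /=.
rewrite exprnP.
by rewrite -expfzDr ?character_neq0 // addNr expr0z.
Qed.

End TorusChart.

Lemma characters_chart n (a : 'I_n -> G -> k) : (forall j, character (a j)) ->
  exists r (u : G -> 'rV[k]_r) (w : G -> k), chart u w /\
    forall j, localization u w (a j) /\ localization u w (fun x => (a j x)^-1).
Proof.
move=> aP; have [r [chi [chiP free aE]]] := free_characters aP.
exists r, (fun x => \row_l chi l x), (fun x => \prod_l chi l x).
split=> [|j]; first exact: torus_chart.
have [e eE] := aE j; split.
  by apply: localization_ext (localization_laurent chiP e) => x; rewrite eE.
apply: localization_ext (localization_laurent chiP (fun l => - e l)) => x.
by rewrite eE /laurent -prodfV; apply: eq_bigr => l _; rewrite invr_expz.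
Qed.

End Characters.

(** * The equivariant embedding *)

Section ChartEmbedding.

Variables (k : fieldType) (G : affine_algebraic_group k).
Variables (n : nat) (u : G -> 'rV[k]_n) (w : G -> k).
Hypothesis uw : chart u w.

Local Notation co := (av_coord (aag_variety G)).

(** The polynomials expressing [u (g * x)] define the action everywhere; its laws hold on the image
    of G and extend by algebraic independence. *)
Lemma chart_action : exists b : algebraic_action G (affine_space_variety k n),
  forall g x, u (g * x)%g = b g (u x).
Proof.
have /fin_all_exists[B BE] := chart_translate uw.
pose act (g : G) (v : 'rV[k]_n) : 'rV[k]_n :=
  \row_i (B i).@[row_mx (co g) v 0].
have actu g x : act g (u x) = u (g * x)%g.
  by apply/rowP => i; rewrite mxE (BE i (g, x)).
have extend (F F' : 'rV[k]_n -> k) : polyfun id F -> polyfun id F' ->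
    (forall x, F (u x) = F' (u x)) -> F =1 F'.
  move=> [p pE] [q qE] eqF v; apply/eqP; rewrite pE qE -subr_eq0 -mevalB.
  rewrite (chart_free uw (p := p - q)) ?meval0 // => x.
  by rewrite mevalB -pE -qE eqF subrr.
have actP g i : polyfun id (fun v => act g v 0 i).
  have : polyfun (fun v : 'rV_n => row_mx (co g) v) (fun v => act g v 0 i).
    by exists (B i) => v; rewrite mxE.
  apply: polyfun_trans; apply: polyfun_row_mx => j; first exact: polyfun_cst.
  exact: polyfun_coord.
have act1 v : act 1%g v = v.
  apply/rowP => i; apply: (extend (fun v => act 1%g v 0 i) (fun v => v 0 i)).
  - exact: actP.
  - exact: polyfun_coord.
  - by move=> x; rewrite actu mul1g.
have actM g h v : act (g * h)%g v = act g (act h v).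
  apply/rowP => i; apply: (extend (fun v => act (g * h)%g v 0 i)
                                  (fun v => act g (act h v) 0 i)).
  - exact: actP.
  - exact: polyfun_trans (actP h) (polyfun_comp (act h) (actP g i)).
  - by move=> x; rewrite !actu mulgA.
have act_mor : is_morphism (prod_variety (aag_variety G) (affine_space_variety k n))
    (affine_space_variety k n) (fun z => act z.1 z.2).
  by exists B => z j; rewrite mxE.
by exists (AlgebraicAction act1 actM act_mor) => g x; rewrite /= actu.
Qed.

Hypothesis coP : forall i, localization u w (fun x => co x 0 i).

(** The fractions expressing the coordinates of G define an inverse [pt] on the locus [om != 0].
    Independence shows that [pt] lands in the closed image of G and that [u] inverts it, so the
    image of [u] is this locus. *)
Lemma chart_open_embedding : open_embedding (aag_variety G) u.
Proof.
have [om omE] := chart_den uw; have w0 := chart_den_neq0 uw.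
have /fin_all_exists[N /fin_all_exists[X XE]] := coP.
pose pt (v : 'rV[k]_n) := \row_i ((X i).@[v 0] / om.@[v 0] ^+ N i).
have ptu x : pt (u x) = co x.
  by apply/rowP => i; rewrite mxE -XE -omE mulrAC mulfV ?mul1r // expf_neq0.
(* On this subset the denominators are nonzero, so [localization_trans] can be used to clear them in
   [ptP]. *)
pose T := {v : 'rV[k]_n | om.@[v 0] != 0}.
have ptP (q : {mpoly k[av_dim (aag_variety G)]}) :
    exists K (Q : {mpoly k[n]}), forall v : 'rV[k]_n, om.@[v 0] != 0 ->
    om.@[v 0] ^+ K * q.@[pt v 0] = Q.@[v 0].
  have omP : polyfun (@sval _ _ : T -> _) (fun t => om.@[sval t 0]) by exists om.
  have [|||K [Q QE]] := @localization_trans k T n (@sval _ _)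
      (fun t => om.@[sval t 0]) _ _ (fun t => pt (sval t)) (fun t => q.@[pt (sval t) 0]).
  - exact: omP.
  - move=> i; exists (N i), (X i) => -[v v0] /=.
    by rewrite mxE mulrC mulfVK ?expf_neq0.
  - by exists q.
  by exists K, Q => v v0; apply: (QE (exist _ v v0)).
have imageP v : (exists x, v = u x) <-> om.@[v 0] != 0.
  split=> [[x ->]|v0]; first by rewrite -omE.
  (* After denominators are cleared, [q] composed with [pt] is a polynomial vanishing on [u x] for
     all [x], hence zero. *)
  have lift q : (forall x, q.@[co x 0] = 0) -> q.@[pt v 0] = 0.
    move=> q0; have [K [Q QE]] := ptP q; have Q0 : Q = 0.
      apply: (chart_free uw) => x; rewrite -QE -?omE // ptu q0 mulr0.
      by [].
    apply/eqP; have := QE v v0; rewrite Q0 meval0 => /eqP.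
    by rewrite mulf_eq0 expf_eq0 (negPf v0) andbF.
  have [S SP] := av_coord_closed (aag_variety G).
  have [|x xE] := (SP (pt v)).2.
    by move=> q Sq; apply: lift => x; apply: (SP (co x)).1 Sq; exists x.
  exists x; apply/rowP => i; have [U UE] := chart_regular uw i.
  have [K [Q QE]] := ptP U.
  have /(congr1 (meval (v 0))) : Q - om ^+ K * 'X_i = 0.
    apply: (chart_free uw) => y; rewrite mevalB mevalM rmorphXn /= mevalXU.
    by rewrite -QE -?omE // ptu -UE subrr.
  rewrite mevalB mevalM rmorphXn /= mevalXU meval0 -QE // => /eqP.
  rewrite subr_eq0 => /eqP/(mulfI (expf_neq0 K v0)) <-.
  by rewrite xE -UE.
have imageO : zariski_open (fun v => exists x, v = u x).
  exists (eq om) => v; split=> [nv _ <-|v0 /imageP].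
    by apply/eqP; have [//|/imageP] := boolP (om.@[v 0] == 0).
  by rewrite v0 ?eqxx.
split=> //.
  have /fin_all_exists[U UE] := chart_regular uw.
  by exists U => x j; apply: UE.
exists pt; split=> // i v /imageP v0.
exists (fun v => exists x, v = u x); split=> //; first exact/imageP.
exists (X i), (om ^+ N i) => y /imageP y0 _.
by rewrite rmorphXn /= expf_neq0 // mxE.
Qed.

Lemma chart_flattenable : equivariantly_flattenable_group G.
Proof.
have [b bE] := chart_action.
by exists n, b, u; split; [apply: chart_open_embedding|apply: bE].
Qed.

End ChartEmbedding.

(* The coordinates span a triangular module v_0, ..., v_(n-1) with diagonal
   characters a_j; since v_j / a_j is translated into itself plus combinations of
   the v_l / a_j with l < j, it can be adjoined as a new variable. *)
Lemma coordinates_chart (k : closedFieldType) (char0 : [pchar k] =i pred0)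
    (G : affine_algebraic_group k) :
  rigid (fun _ : G => True) -> solvable_group G ->
  exists n (u : G -> 'rV[k]_n) w, chart u w /\
    forall i, localization u w (fun x => av_coord (aag_variety G) x 0 i).
Proof.
move=> Grigid Gsolv.
have [n [v [T [vP TP vE T0 [T1 TM coE]]]]] :=
  triangular_module_of_coordinates Grigid Gsolv.
pose a j := T j j.
have aP j : character (a j) by split; [apply: TP|apply: T1|move=> g h; apply: TM].
have a0 j x : a j x != 0 by apply: character_neq0.
have aVP j : regular (fun x => (a j x)^-1).
  exact: character_regular (character_inv (aP j)).
have [r [u0 [w [u0w u0a]]]] := characters_chart Grigid aP.
(* Induction on the number [j] of functions [v l] already obtained; the denominator [w] stays
   fixed. *)
suff /(_ n (leqnn n))[m [u [uw [_ uv]]]] : forall j, (j <= n)%N -> exists m (u : G -> 'rV[k]_m),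
    chart u w /\ (forall l, localization u w (a l) /\
                            localization u w (fun x => (a l x)^-1)) /\
    forall l : 'I_n, (l < j)%N -> localization u w (v l).
  exists m, u, w; split=> // i; have [c cE] := coE i.
  have : localization u w (fun x => \sum_j c j * v j x).
    apply: localization_sum => [|j]; first exact: chart_den uw.
    by apply: localizationM; [apply/localization_polyfun/polyfun_cst|apply: uv].
  by apply: localization_ext => x; rewrite cE.
elim=> [_|j IH lt]; first by exists r, u0.
have [m [u [uw [ua uv]]]] := IH (ltnW lt); pose J := Ordinal lt.
pose f x := v J x / a J x.
(* The value 0 for [l >= j] lets the sum run over all indices: the diagonal term gives [f] itself,
   and the later ones vanish by triangularity. *)
pose c (l : 'I_n) g := if (l < j)%N then T J l g / a J g else 0.
pose b (l : 'I_n) x := if (l < j)%N then v l x / a J x else 0.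
have [|l|l|g x|m' [u' [u'w sub fP]]] := @chart_extend k G char0 m u w f n c b uw.
- exact: polyfunM (vP J) (aVP J).
- rewrite /c; case: (l < j)%N; last exact: polyfun_cst.
  exact: polyfunM (TP J l) (aVP J).
- rewrite /b; have [lj|_] := ltnP l j; last exact/localization_polyfun/polyfun_cst.
  exact: localizationM (uv l lj) (ua J).2.
- rewrite /f vE (characterM (aP J)) (bigD1 J) //= mulrDl; congr (_ + _).
    by rewrite /a invfM mulrACA mulfV ?mul1r ?a0.
  rewrite mulr_suml [RHS](bigD1 J) //= /c ltnn mul0r add0r.
  apply: eq_bigr => l lJ; rewrite /b; case: ltnP => [lj|jl].
    by rewrite invfM mulrACA.
  rewrite (T0 J) ?mul0r //= ltn_neqAle jl andbT eq_sym.
  by [].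
exists m', u'; split=> //; split=> [l|l].
  by have [? ?] := ua l; split; apply: sub.
rewrite ltnS leq_eqVlt => /orP[/eqP el|lj]; last exact/sub/uv.
have -> : l = J by apply: val_inj.
apply: localization_ext (localizationM fP (sub _ (ua J).1)) => x.
by rewrite /f mulfVK.
Qed.

Theorem corollary29 (k : closedFieldType) (hchar : [pchar k]%R =i pred0)
  (G : affine_algebraic_group k)
  (hconn : is_connected (aag_variety G)) (hsolv : solvable_group G) :
  equivariantly_flattenable_group G.
Proof.
have [n [u [w [uw coP]]]] :=
  coordinates_chart hchar (rigid_connected hconn) hsolv.
exact: chart_flattenable uw coP.
Qed.
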